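(* Let $n>2$ be an integer, let $C>1$ be a constant and let $H:[0,+\infty)\rightarrow\mathbb{R}$ be a non-decreasing function such that $x\in\mathbb{R}^n\mapsto H(|x|)\in\mathbb{R}$ is smooth, $$\inf_{[0,+\infty)}H>1\quad\text{and}\quad H(r)\rightarrow C\ \text{ as } r\rightarrow+\infty.$$ Then there exists a radial admissible function $u:\mathbb{R}^n\rightarrow\mathbb{R}$ which is a solution of $$\mathcal{H}_2[u]^{\frac12}(x)=H(|x|)-\frac{1}{\sqrt{1-|Du(x)|^2}}\qquad(x\in\mathbb{R}^n).\qquad(\ast)$$ It is strictly convex and such that $$|Du(x)|\rightarrow\sqrt{1-\frac{1}{C^2}}\quad\text{as }|x|\rightarrow+\infty.$$ Assuming moreover that $$H(r)=C\left(1-O\left(\frac{1}{r^2}\right)\right)\quad\text{as } r\rightarrow+\infty,$$ it satisfies $$u(x)=\sqrt{1-\frac{1}{C^2}}\,|x|-\frac{1}{C^2}\sqrt{\frac{n-2}{n}}\,\log|x|+c_0+o(1)\quad\text{as }|x|\rightarrow+\infty$$ for some constant $c_0\in\mathbb{R}$. In particular (under this additional assumption), the radial admissible solution of $(\ast)$ is unique up to the addition of a constant.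
   Context: For a $C^2$ function $u$ with $|Du|<1$ (a spacelike function), the shape operator of its graph in Minkowski space $\mathbb{R}^{n,1}$ ($\mathbb{R}^{n+1}$ with the metric $dx_1^2+\cdots+dx_n^2-dx_{n+1}^2$) is the matrix $$h^i_j=\frac{1}{\sqrt{1-|Du|^2}}\sum_{k=1}^n\left(\delta_{ik}+\frac{\partial_iu\,\partial_ku}{1-|Du|^2}\right)\partial^2_{kj}u .$$ Its eigenvalues $\lambda_1,\dots,\lambda_n$ are the principal curvatures of the graph. Set $\mathcal{H}_k[u]=\frac{k!(n-k)!}{n!}\sigma_k(\lambda_1,\dots,\lambda_n)$, where $\sigma_k$ is the $k$-th elementary symmetric function. A function $u:\mathbb{R}^n\to\mathbb{R}$ is admissible if it is of class $C^2$ and $|Du|<1$, $\mathcal{H}_1[u]>0$, $\mathcal{H}_2[u]>0$ on $\mathbb{R}^n$. Radial means that $u(x)$ depends only on the Euclidean norm $|x|$. *)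

(* Defs.v *)
(* MathComp-Analysis, over an arbitrary real field R : realType. *)
From HB Require Import structures.
From mathcomp Require Import all_boot all_order all_algebra.
From mathcomp Require Import all_classical all_reals all_analysis.
(* Not imported: its notations clash with those of MathComp-Analysis. *)
From mathcomp Require mpoly.

Set Implicit Arguments.
Unset Strict Implicit.
Unset Printing Implicit Defensive.

Import Order.TTheory GRing.Theory Num.Theory.
Import numFieldNormedType.Exports.

Local Open Scope classical_set_scope.
Local Open Scope ring_scope.

(* R^n is 'rV[R]_n.  The library norm on it is the sup norm, hence enorm; the
   two norms define the same topology, so that the library notions of
   continuity and derivative on 'rV[R]_n are the usual ones. *)
Definition enorm (R : realType) (n : nat) (x : 'rV[R]_n) : R :=
  Num.sqrt (\sum_(i < n) x 0 i ^+ 2).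

(* The filter "|x| -> +oo" on R^n. *)
Definition enorm_oo (R : realType) (n : nat) : set_system 'rV[R]_n :=
  filter_from [set: R] (fun M => [set x | M < enorm x]).

Global Instance enorm_oo_filter (R : realType) (n : nat) :
  Filter (@enorm_oo R n).
Proof.
apply: filter_from_filter; first by exists 0.
move=> M N _ _; exists (Num.max M N) => // x /=.
by rewrite gt_max => /andP[].
Qed.

Definition radial (R : realType) (n : nat) (u : 'rV[R]_n -> R) : Prop :=
  forall x y, enorm x = enorm y -> u x = u y.

Definition pderiv (R : realType) (n : nat) (i : 'I_n) (u : 'rV[R]_n -> R)
    (x : 'rV[R]_n) : R :=
  'D_(delta_mx 0 i) u x.

Definition pderivable (R : realType) (n : nat) (i : 'I_n) (u : 'rV[R]_n -> R) :
    Prop :=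
  forall x, derivable u x (delta_mx 0 i).

(* All iterated partial derivatives of order at most k exist and are
   continuous on R^n. *)
Fixpoint classC (R : realType) (n k : nat) (u : 'rV[R]_n -> R) : Prop :=
  continuous u /\
  match k with
  | 0%N => True
  | k'.+1 => forall i, pderivable i u /\ classC k' (pderiv i u)
  end.

Definition smooth (R : realType) (n : nat) (u : 'rV[R]_n -> R) : Prop :=
  forall k, classC k u.

Definition grad (R : realType) (n : nat) (u : 'rV[R]_n -> R) (x : 'rV[R]_n) :
    'rV[R]_n :=
  \row_(i < n) pderiv i u x.

Definition shape_operator (R : realType) (n : nat) (u : 'rV[R]_n -> R)
    (x : 'rV[R]_n) : 'M[R]_n :=
  let w := 1 - enorm (grad u x) ^+ 2 in
  \matrix_(i < n, j < n)
    ((Num.sqrt w)^-1 *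
     \sum_(k < n) ((i == k)%:R + pderiv i u x * pderiv k u x / w)
                  * pderiv k (pderiv j u) x).

(* The eigenvalues of the shape operator, repeated according to their algebraic
   multiplicity and listed in an unspecified order.  If the characteristic
   polynomial does not split over R, a default value is returned; this does not
   happen when u is spacelike of class C^2, the shape operator being then the
   product of a positive definite and a symmetric matrix. *)
Definition principal_curvatures (R : realType) (n : nat) (u : 'rV[R]_n -> R)
    (x : 'rV[R]_n) : n.-tuple R :=
  xget (nseq_tuple n 0)
    [set l : n.-tuple R |
       char_poly (shape_operator u x) = \prod_(c <- l) ('X - c%:P)].

(* The normalized k-th mean curvature H_k[u](x); mpoly.mesym n R k is the k-th
   elementary symmetric polynomial in n variables. *)
Definition mean_curvature (R : realType) (n k : nat) (u : 'rV[R]_n -> R)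
    (x : 'rV[R]_n) : R :=
  (k`! * (n - k)`!)%N%:R / n`!%:R *
  mpoly.meval (tnth (principal_curvatures u x)) (mpoly.mesym n R k).

Definition admissible (R : realType) (n : nat) (u : 'rV[R]_n -> R) : Prop :=
  classC 2 u /\
  forall x, [/\ enorm (grad u x) < 1,
                0 < mean_curvature 1 u x & 0 < mean_curvature 2 u x].

Definition is_solution (R : realType) (n : nat) (H : R -> R)
    (u : 'rV[R]_n -> R) : Prop :=
  forall x, Num.sqrt (mean_curvature 2 u x) =
            H (enorm x) - (Num.sqrt (1 - enorm (grad u x) ^+ 2))^-1.

Definition strictly_convex (R : realType) (n : nat) (u : 'rV[R]_n -> R) :
    Prop :=
  forall (x y : 'rV[R]_n) (t : R), x != y -> 0 < t < 1 ->
    u (t *: x + (1 - t) *: y) < t * u x + (1 - t) * u y.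

(* Main.v *)
Require Import Defs.
From HB Require Import structures.
From mathcomp Require Import all_boot all_order all_algebra.
From mathcomp Require Import all_classical all_reals all_analysis.
From mathcomp Require Import ring lra.

Set Implicit Arguments.
Unset Strict Implicit.
Unset Printing Implicit Defensive.

Import Order.TTheory GRing.Theory Num.Theory.
Import numFieldNormedType.Exports.

Local Open Scope classical_set_scope.
Local Open Scope ring_scope.

(** The problem reduces to one ordinary differential equation. Write
    [u x = f |x|], call [g = f' / sqrt (1 - f'^2)] the tilt and
    [sqrt (1 + g^2) = 1 / sqrt (1 - f'^2)] the lapse. The shape operator is a
    scalar matrix plus a matrix of rank one, with eigenvalues [g'] in the radial
    direction and [g / r], repeated, in the others
    ([mean_curvatures_radial]). With [m = n - 2] and [G = g^2] the equation
    becomes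
      [(r^m G)' = n r^(m+1) (H - sqrt (1 + G))^2]
    ([is_derive_weighted_tilt]), in which the right-hand side decreases with
    [G].

    Uniqueness follows from this monotonicity: the square of the difference of
    [r^m G] for two solutions is nonincreasing and starts at 0. Positivity of
    the mean curvature fixes the sign of [g], and [g] determines [f']
    ([tilt_unique], [radial_solution_unique]).

    For existence the right-hand side is truncated where [H < sqrt (1 + G)],
    which makes it globally Lipschitz in [G], and Picard iteration converges on
    all of [0, +oo) ([exists_squared_tilt]). Everything else rests on one
    inequality, [margin_gt0]: with [kappa = sqrt (m / n)],
      [H - sqrt (1 + G) > kappa g / r].
    It holds near 0, where [g / r] tends to [H 0 - 1], and it cannot fail for
    the first time, because [g] would then be stationary and
    [sqrt (1 + G) + kappa g / r] decreasing, while [H] does not decrease. It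
    shows that the truncation was inactive, that [H_2 > 0], and that [g' > 0],
    hence that [f] is convex. As [sqrt (1 + G) < C], the tilt has a limit, and
    the equation forces [sqrt (1 + G)] to tend to [C] ([lapse_lim]). To see that
    [u] is of class C^2 at the origin it is written as a function of [|x|^2],
    whose second derivative may blow up there, but slowly enough
    ([classC2_radial]).

    For the asymptotics the margin [E = H - sqrt (1 + G) - kappa g / r]
    is bounded by a constant times [G'] ([margin_le_dG]), so it is integrable,
    [G] being bounded. If [C - H = O(r^-2)] then [C - sqrt (1 + G)], which is
    [E + kappa g / r + (C - H)], equals [kappa sqrt (C^2 - 1) / r] up to an
    integrable term, and a Taylor expansion of the slope at the limit cone gives
      [f' = sqrt (1 - 1 / C^2) - kappa / (C^2 r) + (integrable)]
    ([slope_defect], [profile_asymptotics]). *)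

(** * Derivatives and growth of real functions *)

Section DerivativeRules.
Variables (R : realType) (V : normedModType R).
Implicit Types (f g : V -> R) (x v : V).

Lemma is_derive_cstfun (a : R) x v : is_derive x v (fun=> a) 0.
Proof. exact: is_derive_cst. Qed.

Lemma is_derive_addfun f g x v (a b : R) : is_derive x v f a ->
  is_derive x v g b -> is_derive x v (fun y => f y + g y) (a + b).
Proof. by move=> fa gb; exact: is_deriveD. Qed.

Lemma is_derive_oppfun f x v (a : R) : is_derive x v f a ->
  is_derive x v (fun y => - f y) (- a).
Proof. by move=> fa; exact: is_deriveN. Qed.

Lemma is_derive_subfun f g x v (a b : R) : is_derive x v f a ->
  is_derive x v g b -> is_derive x v (fun y => f y - g y) (a - b).
Proof. by move=> fa gb; exact: is_deriveB. Qed.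

Lemma is_derive_mulfun f g x v (a b : R) : is_derive x v f a ->
  is_derive x v g b -> is_derive x v (fun y => f y * g y) (f x * b + g x * a).
Proof. by move=> fa gb; exact: is_deriveM. Qed.

Lemma is_derive_expfun f k x v (a : R) : is_derive x v f a ->
  is_derive x v (fun y => f y ^+ k) (k%:R * f x ^+ k.-1 * a).
Proof. by move=> fa; have := is_deriveX k fa; rewrite exprfctE. Qed.

Lemma is_derive_invfun f x v (a : R) : is_derive x v f a -> f x != 0 ->
  is_derive x v (fun y => (f y)^-1) (- (f x) ^- 2 * a).
Proof.
move=> [df <-] fx0; apply: DeriveDef; first exact: derivableV.
by rewrite deriveV.
Qed.

End DerivativeRules.

Section RealDerivatives.
Variable R : realType.
Implicit Types (f g df : R -> R).

Lemma is_derive_idfun (x : R) : is_derive x 1 (fun y : R => y) 1.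
Proof. exact: is_derive_id. Qed.

Lemma is_derive_compfun f g (x a b : R) : is_derive (g x) 1 f a ->
  is_derive x 1 g b -> is_derive x 1 (fun y => f (g y)) (a * b).
Proof. by move=> fa gb; exact: is_derive1_comp. Qed.

Lemma is_derive_sqrtfun f (x a : R) : is_derive x 1 f a -> 0 < f x ->
  is_derive x 1 (fun y => Num.sqrt (f y)) ((2 * Num.sqrt (f x))^-1 * a).
Proof.
by move=> fa fx0; apply: is_derive_compfun fa; exact: is_derive1_sqrt.
Qed.

Lemma is_derive_continuous f (x a : R) : is_derive x 1 f a ->
  {for x, continuous f}.
Proof.
by move=> [df _]; apply/differentiable_continuous/derivable1_diffP.
Qed.

Lemma continuous_addfun (T : topologicalType) (f g : T -> R) (x : T) :
  {for x, continuous f} -> {for x, continuous g} ->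
  {for x, continuous (fun y => f y + g y)}.
Proof. exact: cvgD. Qed.

Lemma continuous_mulfun (T : topologicalType) (f g : T -> R) (x : T) :
  {for x, continuous f} -> {for x, continuous g} ->
  {for x, continuous (fun y => f y * g y)}.
Proof. exact: cvgM. Qed.

Lemma continuous_at_zero (T : topologicalType) (f : T -> R) (x : T) :
  f x = 0 -> (forall e, 0 < e -> \forall y \near x, `|f y| <= e) ->
  {for x, continuous f}.
Proof.
by move=> fx f0; rewrite /prop_for /continuous_at fx; exact/cvgr0Pnorm_le.
Qed.

Lemma is_derive_near f g (x a : R) : (\forall y \near x, f y = g y) ->
  is_derive x 1 f a -> is_derive x 1 g a.
Proof. exact: near_eq_is_derive. Qed.

Lemma is_derive_line (V : normedModType R) (f : V -> R) (x v : V) (a : R) :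
  is_derive x v f a <-> is_derive (0 : R) 1 (fun t : R => f (t *: v + x)) a.
Proof.
have line : 'D_v f x = 'D_1 (fun t : R => f (t *: v + x)) 0.
  rewrite /derive; set g1 := fun h => h^-1 *: _; set g2 := fun h => h^-1 *: _.
  suff -> : g1 = g2 by [].
  by rewrite funeqE /g1 /g2 => k /=; rewrite addr0 scale0r add0r [_%:A]mulr1.
split=> -[df <-].
  by apply: DeriveDef; [exact: (derivable1P _ _ _).1|rewrite line].
by apply: DeriveDef; [exact: (derivable1P _ _ _).2|rewrite line].
Qed.

(** Derivatives along a vector are derivatives on a line, so the chain rule
    holds for them without any differentiability of the inner function. *)
Lemma is_derive_comp_dir (V : normedModType R) (f : R -> R) (g : V -> R)
    (x v : V) (a b : R) :
  is_derive (g x) 1 f a -> is_derive x v g b ->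
  is_derive x v (fun y => f (g y)) (a * b).
Proof.
move=> Df /is_derive_line Dg; apply/is_derive_line.
by apply: is_derive_compfun Dg; rewrite scale0r add0r.
Qed.

Lemma le_of_derive f df (a b : R) : a <= b ->
  {within `[a, b], continuous f} ->
  (forall x, a < x < b -> is_derive x 1 f (df x)) ->
  (forall x, a < x < b -> 0 <= df x) -> f a <= f b.
Proof.
rewrite le_eqVlt => /orP[/eqP->//|ab] cf Df df0.
have Df' x : x \in `]a, b[ -> is_derive x 1 f (df x).
  by rewrite in_itv; exact: Df.
have [c cab] := MVT ab Df' cf.
move/eqP; rewrite subr_eq => /eqP->.
by rewrite lerDr mulr_ge0 ?subr_ge0 ?(ltW ab)// df0//.
Qed.

Lemma lt_of_derive f df (a b : R) : a < b ->
  {within `[a, b], continuous f} ->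
  (forall x, a < x < b -> is_derive x 1 f (df x)) ->
  (forall x, a < x < b -> 0 < df x) -> f a < f b.
Proof.
move=> ab cf Df df0.
have Df' x : x \in `]a, b[ -> is_derive x 1 f (df x).
  by rewrite in_itv; exact: Df.
have [c cab] := MVT ab Df' cf.
move/eqP; rewrite subr_eq => /eqP->.
by rewrite ltrDr mulr_gt0 ?subr_gt0// df0//.
Qed.

Lemma within_continuous_derive f df (a b : R) :
  (forall x, a <= x <= b -> is_derive x 1 f (df x)) ->
  {within `[a, b], continuous f}.
Proof.
move=> Df; apply: derivable_within_continuous => x.
by rewrite in_itv/= => /Df[].
Qed.

Lemma within_continuous_for f (a b : R) :
  (forall x, a <= x <= b -> {for x, continuous f}) ->
  {within `[a, b], continuous f}.
Proof.
move=> cf; apply: continuous_in_subspaceT => x.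
by rewrite inE/= in_itv/=; exact: cf.
Qed.

(** Mean value inequality with a variable bound: a function whose derivative
    is dominated by that of [g] grows at most as fast as [g]. *)
Lemma norm_le_of_derive f g df dg (b : R) : 0 <= b ->
  (forall x, 0 <= x -> {for x, continuous f}) ->
  (forall x, 0 <= x -> {for x, continuous g}) ->
  (forall x, 0 < x < b -> is_derive x 1 f (df x)) ->
  (forall x, 0 < x < b -> is_derive x 1 g (dg x)) ->
  (forall x, 0 < x < b -> `|df x| <= dg x) -> f 0 = 0 -> g 0 = 0 ->
  `|f b| <= g b.
Proof.
move=> b0 cf cg Df Dg dfg f0 g0; rewrite ler_norml; apply/andP; split.
- suff : f 0 + g 0 <= f b + g b by rewrite f0 g0; lra.
  apply: (@le_of_derive (fun x => f x + g x) (fun x => df x + dg x)) => //.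
  + apply: within_continuous_for => x /andP[x0 _].
    by apply: cvgD; [exact: cf|exact: cg].
  + by move=> x xb; apply: is_derive_addfun; [exact: Df|exact: Dg].
  + move=> x /dfg; rewrite ler_norml; lra.
- suff : g 0 - f 0 <= g b - f b by rewrite f0 g0; lra.
  apply: (@le_of_derive (fun x => g x - f x) (fun x => dg x - df x)) => //.
  + apply: within_continuous_for => x /andP[x0 _].
    by apply: cvgB; [exact: cg|exact: cf].
  + by move=> x xb; apply: is_derive_subfun; [exact: Dg|exact: Df].
  + move=> x /dfg; rewrite ler_norml; lra.
Qed.

(** The fundamental theorem of calculus gives a derivative at the right of the
    lower limit of integration; starting at [-1] makes it available at [0]. *)
Lemma exists_primitive f : continuous f ->
  exists F : R -> R, F 0 = 0 /\ forall x : R, -1 < x -> is_derive x 1 F (f x).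
Proof.
move=> cf; pose I (x : R) : R := (\int[lebesgue_measure]_(t in `[(-1), x]) f t)%R.
have DI (x : R) : -1 < x -> is_derive x 1 I (f x).
  move=> x1; have xx1 : x < x + 1 by rewrite ltrDl.
  have [] := @continuous_FTC1_closed R f (-1) x (x + 1) xx1 _ x1 (cf x).
    apply: continuous_compact_integrable; first exact: segment_compact.
    exact: continuous_subspaceT.
  by rewrite derive1E => dI DI; exact: DeriveDef.
exists (fun x => I x - I 0); split; first by rewrite subrr.
move=> x /DI Dx; rewrite -[X in is_derive _ _ _ X]subr0.
by apply: is_derive_subfun => //; exact: is_derive_cstfun.
Qed.

End RealDerivatives.

(** [p r / r] as a function of [r ^+ 2]. *)
Lemma is_derive_ratio_sqrt (R : realType) (p : R -> R) (dp s : R) : 0 < s ->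
  is_derive (Num.sqrt s) 1 p dp ->
  is_derive s 1 (fun t => p (Num.sqrt t) / Num.sqrt t)
    ((dp - p (Num.sqrt s) / Num.sqrt s) / s / 2).
Proof.
move=> s0 Dp; have r0 : 0 < Num.sqrt s by rewrite sqrtr_gt0.
have Dr := is_derive_sqrtfun (is_derive_idfun s) s0.
have := is_derive_mulfun (is_derive_compfun Dp Dr)
  (is_derive_invfun Dr (lt0r_neq0 r0)).
move/is_derive_eq; apply.
rewrite -[in RHS](@sqr_sqrtr _ s) ?(ltW s0)//.
by rewrite sqrtr_sqr gtr0_norm//; field; rewrite gt_eqF.
Qed.

Section FirstZero.
Variable R : realType.

Lemma derive_ge0_left (f : R -> R) (a x d : R) : is_derive x 1 f d ->
  a < x -> (forall y, a < y < x -> f y <= f x) -> 0 <= d.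
Proof.
move=> [df <-] ax fx; rewrite ['D_1 f x]cvg_at_leftE; last exact: df.
apply: limr_ge.
  rewrite -(cvg_at_leftE (fun h => h^-1 *: ((f \o shift x) _ - f x)))//.
  apply: cvg_trans df; apply: cvg_app.
  move=> A [e egt0 Ae]; exists e => // y ye ygt0; apply: Ae => //.
  exact/ltr0_neq0.
near=> k; apply: mulr_le0.
  by rewrite invr_le0; apply: ltW; near: k; exists 1 => /=.
rewrite subr_le0 [_%:A]mulr1; apply: fx.
have k0 : k < 0 by near: k; exact: nbhs_left_lt.
have ka : a - x < k by near: k; apply: nbhs_left_gt; rewrite subr_lt0.
by rewrite /=; lra.
Unshelve. all: by end_near. Qed.

(** Barrier principle: a function that is positive at first can only become
    nonpositive by passing through a first zero. *)
Lemma gt0_of_no_first_zero (E : R -> R) :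
  (forall r, 0 < r -> {for r, continuous E}) ->
  (\forall r \near 0^'+, 0 < E r) ->
  (forall r, 0 < r -> E r = 0 -> (forall s, 0 < s < r -> 0 < E s) -> False) ->
  forall r, 0 < r -> 0 < E r.
Proof.
move=> cE [d /= d0 Ed] noz r1 r1_gt0; rewrite ltNge; apply/negP => Er1.
pose A := [set r | 0 < r /\ E r <= 0].
have infA : has_inf A.
  by split; [exists r1|exists 0 => r [/ltW]].
have before s : 0 < s < inf A -> 0 < E s.
  move=> /andP[s0 sA]; rewrite ltNge; apply/negP => Es.
  by move: sA; rewrite ltNge => /negP; apply; apply: ge_inf => //; exact: infA.2.
have rA : d <= inf A.
  apply: lb_le_inf; first by exists r1.
  move=> r [r0 Er]; rewrite leNgt; apply/negP => rd.
  suff : 0 < E r by rewrite ltNge Er.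
  by apply: Ed => //; rewrite /ball_ /= sub0r normrN gtr0_norm.
have r0 : 0 < inf A by exact: lt_le_trans rA.
apply: (noz (inf A)) => //; apply/le_anti/andP; split.
  rewrite leNgt; apply/negP => EA.
  have /cvgrPdist_lt/(_ _ EA)[e /= e0 He] := cE _ r0.
  have [x [x0 Ex] xe] := inf_adherent e0 infA.
  have Ax : inf A <= x by apply: ge_inf => //; exact: infA.2.
  have : `|E (inf A) - E x| < E (inf A).
    by apply: He; rewrite /ball_/= distrC ger0_norm ?subr_ge0//; lra.
  by rewrite ltr_norml; lra.
have cl : E x @[x --> (inf A)^'-] --> E (inf A).
  by apply: cvg_at_left_filter; exact: cE.
rewrite -(cvg_lim _ cl)//; apply: limr_ge; first by apply/cvg_ex; exists (E (inf A)).
near=> s; apply/ltW/before; apply/andP; split; near: s.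
  exact: nbhs_left_gt.
exact: nbhs_left_lt.
Unshelve. all: by end_near. Qed.

End FirstZero.

Section DominatedDerivative.
Variable R : realType.

Lemma nondecreasing_from_cvg (f : R -> R) (a B : R) :
  (forall x y, a <= x -> x <= y -> f x <= f y) ->
  (forall x, a <= x -> f x <= B) -> exists l : R, f x @[x --> +oo] --> l.
Proof.
move=> mono bnd; pose g x := f (Num.max a x).
have am x : a <= Num.max a x by rewrite le_max lexx.
have gl : g x @[x --> +oo] --> sup (range g).
  apply: nondecreasing_cvgr.
    by move=> x y xy; apply: mono => //; rewrite ge_max am le_max xy orbT.
  by exists B => _ [x _ <-]; exact: bnd.
exists (sup (range g)); apply: cvg_trans gl; apply: near_eq_cvg; near=> x.
rewrite /g max_r//; near: x; apply: nbhs_pinfty_ge; exact: num_real.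
Unshelve. all: by end_near. Qed.

(** A function whose derivative is dominated by that of a bounded monotone
    function has a limit, the derivative being absolutely integrable. *)
Lemma cvg_of_dominated_derive (f df g dg : R -> R) (a B : R) :
  (forall x : R, a <= x -> is_derive x 1 f (df x)) ->
  (forall x : R, a <= x -> is_derive x 1 g (dg x)) ->
  (forall x, a <= x -> `|df x| <= dg x) -> (forall x, a <= x -> `|g x| <= B) ->
  exists l : R, f x @[x --> +oo] --> l.
Proof.
move=> Df Dg dfg gB.
have g_mono x y : a <= x -> x <= y -> g x <= g y.
  move=> ax xy; apply: (@le_of_derive _ g dg) => //.
  - by apply: (@within_continuous_derive _ g dg) => t /andP[xt _]; apply: Dg; lra.
  - by move=> t /andP[xt _]; apply: Dg; lra.
  - move=> t /andP[xt _]; apply: le_trans (dfg t _); [exact: normr_ge0|lra].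
have fg_mono x y : a <= x -> x <= y -> f x + g x <= f y + g y.
  move=> ax xy.
  apply: (@le_of_derive _ (fun t => f t + g t) (fun t => df t + dg t)) => //.
  - apply: (@within_continuous_derive _ _ (fun t => df t + dg t)) => t /andP[xt _].
    by apply: is_derive_addfun; [apply: Df|apply: Dg]; lra.
  - move=> t /andP[xt _].
    by apply: is_derive_addfun; [apply: Df|apply: Dg]; lra.
  - move=> t /andP[xt _]; have at' : a <= t by lra.
    by have := dfg t at'; rewrite ler_norml; lra.
have fg_anti x : a <= x -> g a - f a <= g x - f x.
  move=> ax.
  apply: (@le_of_derive _ (fun t => g t - f t) (fun t => dg t - df t)) => //.
  - apply: (@within_continuous_derive _ _ (fun t => dg t - df t)) => t /andP[xt _].
    by apply: is_derive_subfun; [apply: Dg|apply: Df]; lra.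
  - move=> t /andP[xt _].
    by apply: is_derive_subfun; [apply: Dg|apply: Df]; lra.
  - move=> t /andP[xt _]; have at' : a <= t by lra.
    by have := dfg t at'; rewrite ler_norml; lra.
have g_le x : a <= x -> - B <= g x <= B.
  by move=> /gB; rewrite ler_norml.
have [l1 gl] : exists l : R, g x @[x --> +oo] --> l.
  by apply: (@nondecreasing_from_cvg _ a B) => // x /g_le/andP[].
have [l2 fl] : exists l : R, f x + g x @[x --> +oo] --> l.
  apply: (@nondecreasing_from_cvg _ a (f a - g a + 2 * B)) => // x ax.
  have := fg_anti x ax; have /andP[_] := g_le x ax; lra.
exists (l2 - l1).
have c : f x + g x - g x @[x --> +oo] --> l2 - l1 by exact: cvgB.
apply: cvg_trans c; apply: near_eq_cvg; near=> x.
by rewrite addrK.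
Unshelve. all: by end_near. Qed.

End DominatedDerivative.

(** * Curvatures of a matrix that is scalar up to rank one *)

Section CharacteristicPolynomial.

(** Comparing two block factorizations, as in Sylvester's determinant identity,
    without dividing by [a]. *)
Lemma det_scalar_sub_rank1 (K : comNzRingType) n (a : K) (u : 'cV[K]_n)
    (v : 'rV[K]_n) :
  a * \det (a%:M - u *m v) = a ^+ n * (a - (v *m u) 0 0).
Proof.
pose B : 'M[K]_(1 + n) := block_mx 1%:M v u a%:M.
pose L : 'M[K]_(1 + n) := block_mx 1%:M 0 (- u) 1%:M.
pose S : 'M[K]_(1 + n) := block_mx a%:M 0 (- u) 1%:M.
have LB : L *m B = block_mx 1%:M v 0 (a%:M - u *m v).
  by rewrite mulmx_block !mul1mx !mul0mx !addr0 mulmx1 addNr mulNmx addrC.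
have BS : B *m S = block_mx (a%:M - v *m u) v 0 a%:M.
  rewrite mulmx_block !mulmx0 !mulmx1 !add0r mul1mx mulmxN.
  by rewrite mul_mx_scalar mul_scalar_mx scalerN addrN.
have detB : \det B = \det (a%:M - u *m v).
  have := congr1 determinant LB; rewrite det_mulmx det_lblock det_ublock.
  by rewrite !det1 !mul1r.
have := congr1 determinant BS; rewrite det_mulmx detB det_lblock det_ublock.
rewrite det1 mulr1 !det_scalar expr1 mulrC => ->.
by rewrite det_mx11 !mxE eqxx mulr1n mulrC.
Qed.

Lemma char_poly_rank1 (K : idomainType) n (a b : K) (v : 'rV[K]_n.+1) :
  char_poly (a%:M + b *: (v^T *m v)) =
  ('X - a%:P) ^+ n * ('X - (a + b * \sum_i v 0 i ^+ 2)%:P).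
Proof.
pose u := map_mx polyC (- (b *: v^T)); pose w := map_mx polyC v.
have -> : char_poly (a%:M + b *: (v^T *m v)) = \det (('X - a%:P)%:M - (- u) *m w).
  rewrite /char_poly /char_poly_mx; congr (\det _).
  rewrite map_mxD /= map_scalar_mx /= /u mulNmx opprK -map_mxM /=.
  rewrite mulNmx map_mxN /= -scalemxAl opprD addrA.
  by rewrite -raddfB /=.
have Xa0 : 'X - a%:P != 0 by rewrite polyXsubC_eq0.
apply: (mulfI Xa0); rewrite det_scalar_sub_rank1 exprS -!mulrA.
congr (_ * (_ * _)); rewrite polyCD opprD addrA; congr (_ - _).
rewrite mulmxN !mxE -sumrN rmorphM rmorph_sum mulr_sumr; apply: eq_bigr => i _.
by rewrite !mxE expr2 /= polyCN !polyCM; ring.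
Qed.

End CharacteristicPolynomial.

Section TopCoefficients.
Variable K : comNzRingType.

Lemma coef_XsubC_exp (a : K) k :
  [/\ (('X - a%:P) ^+ k.+2)`_k.+2 = 1,
      (('X - a%:P) ^+ k.+2)`_k.+1 = - (k.+2%:R * a) &
      (('X - a%:P) ^+ k.+2)`_k *+ 2 = (k.+2 * k.+1)%:R * a ^+ 2].
Proof.
have step (p : {poly K}) i : (p * ('X - a%:P))`_i.+1 = p`_i - p`_i.+1 * a.
  by rewrite mulrBr coefB coefMX coefMC.
have top k' : (('X - a%:P) ^+ k')`_k'.+1 = 0.
  by rewrite nth_default// size_exp_XsubC.
elim: k => [|k [IH2 IH1 IH0]].
  split; first by rewrite expr2 step !coefB !coefX !coefC /=; ring.
    by rewrite expr2 step !coefB !coefX !coefC /=; ring.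
  by rewrite [in LHS]expr2 coefM big_ord1 !coefB !coefX !coefC /=; ring.
split; rewrite exprSr !step.
- by rewrite IH2 top mul0r subr0.
- by rewrite IH1 IH2 -[k.+3%:R]natr1; ring.
- rewrite mulrnBl IH0 -mulrnAl IH1 !natrM -[k.+3%:R]natr1 -[k.+2%:R]natr1; ring.
Qed.

End TopCoefficients.

Section MeanCurvatures.
Variables (R : realType) (m : nat).
Hypothesis m_gt0 : (0 < m)%N.
Implicit Types (u : 'rV[R]_m.+2 -> R) (x : 'rV[R]_m.+2).

(** The mean curvatures are coefficients of the characteristic polynomial, so
    they do not depend on the order in which the eigenvalues are listed. *)
Lemma mean_curvatureE k u x (l : m.+2.-tuple R) : (k <= m.+2)%N ->
  char_poly (shape_operator u x) = \prod_(c <- l) ('X - c%:P) ->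
  mean_curvature k u x = (k`! * (m.+2 - k)`!)%N%:R / m.+2`!%:R *
    ((-1) ^+ k * (char_poly (shape_operator u x))`_(m.+2 - k)).
Proof.
move=> km Hl; rewrite /mean_curvature; congr (_ * _).
set t := principal_curvatures u x.
have <- : \prod_(c <- t) ('X - c%:P) = char_poly (shape_operator u x).
  rewrite /t /principal_curvatures; apply/esym.
  by apply: (@xgetPex _ (nseq_tuple m.+2 0) [set l : m.+2.-tuple R |
       char_poly (shape_operator u x) = \prod_(c <- l) ('X - c%:P)]); exists l.
have km1 : (k < m.+3)%N by [].
have := @mpoly.mroots_coeff R m.+2 t (Ordinal km1) => /= ->.
by rewrite mulrA -expr2 sqrr_sign mul1r.
Qed.

Lemma mean_curvatures u x (a b : R) :
  char_poly (shape_operator u x) = ('X - a%:P) ^+ m.+1 * ('X - b%:P) ->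
  mean_curvature 1 u x = (m.+1%:R * a + b) / m.+2%:R /\
  mean_curvature 2 u x = (m%:R * a ^+ 2 + 2 * (a * b)) / m.+2%:R.
Proof.
move=> Hq; pose l := [tuple of b :: nseq m.+1 a].
have Hl : char_poly (shape_operator u x) = \prod_(c <- l) ('X - c%:P).
  by rewrite Hq big_cons big_nseq iter_mulr_1 mulrC.
rewrite !(mean_curvatureE _ Hl)// Hq !subSS !subn0.
rewrite mulrBr !coefB !coefMX !coefMC.
case: m m_gt0 => // k _ /=.
have [c2 c1 c0] := coef_XsubC_exp a k.
have {}c0 : (('X - a%:P) ^+ k.+2)`_k = (k.+2 * k.+1)%:R * a ^+ 2 / 2.
  by rewrite -c0 -[X in X / _]mulr_natr mulfK ?pnatr_eq0.
rewrite c2 c1 c0 !factS !natrM fact0.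
have f0 : k`!%:R != 0 :> R by rewrite pnatr_eq0 -lt0n fact_gt0.
by split; field; rewrite f0 -!natrD nat1r !pnatr_eq0.
Qed.

End MeanCurvatures.

(** * Radial functions on Euclidean space *)

Section SquaredNorm.
Variables (R : realType) (n : nat).
Implicit Types x y : 'rV[R]_n.

Definition sqnorm x : R := \sum_(i < n) x 0 i ^+ 2.

Lemma sqnorm_ge0 x : 0 <= sqnorm x.
Proof. by apply: sumr_ge0 => i _; exact: sqr_ge0. Qed.

Lemma enorm_ge0 x : 0 <= enorm x. Proof. exact: sqrtr_ge0. Qed.

Lemma enorm_sqr x : enorm x ^+ 2 = sqnorm x.
Proof. by rewrite sqr_sqrtr// sqnorm_ge0. Qed.

Lemma sqnorm0 : sqnorm 0 = 0.
Proof. by apply: big1 => i _; rewrite mxE expr0n. Qed.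

Lemma sqnorm_eq0 x : (sqnorm x == 0) = (x == 0).
Proof.
apply/eqP/eqP => [|->]; last exact: sqnorm0.
move=> /psumr_eq0P H; apply/rowP => i; rewrite mxE.
by apply/eqP; rewrite -sqrf_eq0; apply/eqP/H => // j _; exact: sqr_ge0.
Qed.

Lemma sqnorm_gt0 x : (0 < sqnorm x) = (x != 0).
Proof. by rewrite lt_def sqnorm_ge0 andbT sqnorm_eq0. Qed.

Lemma enormZ (a : R) x : enorm (a *: x) = `|a| * enorm x.
Proof.
rewrite /enorm -sqrtr_sqr -sqrtrM ?sqr_ge0//; congr Num.sqrt.
by rewrite mulr_sumr; apply: eq_bigr => i _; rewrite mxE exprMn.
Qed.

Lemma sqr_coord_le x i : x 0 i ^+ 2 <= sqnorm x.
Proof.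
rewrite /sqnorm (bigD1 i)//= lerDl; apply: sumr_ge0 => j _; exact: sqr_ge0.
Qed.

Lemma continuous_coord i : continuous (fun x => x 0 i).
Proof. exact: coord_continuous. Qed.

Lemma continuous_sqnorm : continuous sqnorm.
Proof.
apply: continuous_big => [|i _ x]; first exact: add_continuous.
apply: (@continuous_comp _ _ _ (fun x => x 0 i) (fun t => t ^+ 2)).
  exact: continuous_coord.
exact: exprn_continuous.
Qed.

Lemma is_derive_coord x i j :
  is_derive x (delta_mx 0 j) (fun y => y 0 i) (i == j)%:R.
Proof.
apply/is_derive_line.
have := is_derive_addfun (is_derive_mulfun (is_derive_idfun (0 : R))
  (is_derive_cstfun (i == j)%:R (0 : R) 1)) (is_derive_cstfun (x 0 i) (0 : R) 1).
rewrite mulr0 add0r mulr1 addr0.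
by congr is_derive; apply/funext => t; rewrite !mxE eqxx.
Qed.

Lemma is_derive_sqnorm x j : is_derive x (delta_mx 0 j) sqnorm (2 * x 0 j).
Proof.
have -> : sqnorm = \sum_(i < n) (fun y => y 0 i ^+ 2).
  by apply/funext => y; rewrite fct_sumE.
have -> : 2 * x 0 j = \sum_(i < n) (2%:R * x 0 i ^+ 1 * (i == j)%:R).
  rewrite (bigD1 j)//= eqxx mulr1 expr1 big1 ?addr0// => i /negbTE->.
  by rewrite mulr0.
by apply: is_derive_sum => i; apply: is_derive_expfun; exact: is_derive_coord.
Qed.

End SquaredNorm.

Section RadialDerivatives.
Variables (R : realType) (n : nat).
Implicit Types (x : 'rV[R]_n) (u : 'rV[R]_n -> R) (U M N : R -> R).

(** The gradient of [sqnorm] is [2 x]; prescribing half of [M] as the derivative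
    of [U], and half of [N] as that of [M], keeps the formulas free of factors. *)
Lemma is_derive_radial U M x i : is_derive (sqnorm x) 1 U (M (sqnorm x) / 2) ->
  is_derive x (delta_mx 0 i) (fun y => U (sqnorm y)) (M (sqnorm x) * x 0 i).
Proof.
move=> DU; have := is_derive_comp_dir DU (is_derive_sqnorm x i).
by rewrite mulrA divfK.
Qed.

Lemma is_derive_radial_field M N x i j :
  is_derive (sqnorm x) 1 M (N (sqnorm x) / 2) ->
  is_derive x (delta_mx 0 j) (fun y => M (sqnorm y) * y 0 i)
    (M (sqnorm x) * (i == j)%:R + N (sqnorm x) * x 0 i * x 0 j).
Proof.
move=> /(@is_derive_radial M N x j) DM.
have := is_derive_mulfun DM (is_derive_coord x i j).
by rewrite mulrCA mulrA.
Qed.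

(** At the origin continuity of [M] is enough. *)
Lemma is_derive_radial_field0 M i j : {for 0, continuous M} ->
  is_derive (0 : 'rV[R]_n) (delta_mx 0 j) (fun y => M (sqnorm y) * y 0 i)
    (M 0 * (i == j)%:R).
Proof.
move=> cM.
pose k t := M (sqnorm (t *: delta_mx 0 j : 'rV[R]_n)) * (i == j)%:R.
have lim : (fun t : R => t^-1 *: (((fun y : 'rV[R]_n => M (sqnorm y) * y 0 i)
    \o shift 0) (t *: delta_mx 0 j) - M (sqnorm (0 : 'rV[R]_n)) *
    (0 : 'rV[R]_n) 0 i)) @ 0^' --> M 0 * (i == j)%:R.
  have ck : {for 0, continuous k}.
    apply: cvgMl; apply: continuous_comp; last by rewrite scale0r sqnorm0.
    apply: continuous_comp; last exact: continuous_sqnorm.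
    exact: scalel_continuous.
  have k0 : k 0 = M 0 * (i == j)%:R by rewrite /k scale0r sqnorm0.
  move/continuous_withinNx: ck; rewrite -k0; apply: cvg_trans.
  apply: near_eq_cvg; near=> t.
  have t0 : t != 0 by near: t; exact: nbhs_dnbhs_neq.
  rewrite /k /= addr0 !mxE mulr0 subr0 eqxx andTb.
  rewrite /GRing.scale/= [M _ * (t * _)]mulrCA mulKf//.
apply: DeriveDef; first by apply/cvg_ex; exists (M 0 * (i == j)%:R).
exact: cvg_lim.
Unshelve. all: by end_near. Qed.

End RadialDerivatives.

Section RadialCurvatures.
Variables (R : realType) (m : nat).
Local Notation n := m.+2.
Implicit Types (x : 'rV[R]_n) (u : 'rV[R]_n -> R).

Lemma enorm_grad_radial u x (a : R) :
  (forall i, pderiv i u x = a * x 0 i) ->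
  enorm (grad u x) ^+ 2 = a ^+ 2 * sqnorm x.
Proof.
move=> Du; rewrite enorm_sqr /sqnorm mulr_sumr; apply: eq_bigr => i _.
by rewrite mxE Du exprMn.
Qed.

Lemma shape_operator_radial u x (a b : R) : 0 < 1 - a ^+ 2 * sqnorm x ->
  (forall i, pderiv i u x = a * x 0 i) ->
  (forall j k, pderiv k (pderiv j u) x =
     a * (j == k)%:R + b * x 0 j * x 0 k) ->
  let w := 1 - a ^+ 2 * sqnorm x in
  shape_operator u x =
    (a / Num.sqrt w)%:M + ((b + a ^+ 3) / (w * Num.sqrt w)) *: (x^T *m x).
Proof.
move=> w0 Du D2u w; rewrite -/w in w0; apply/matrixP => i j.
rewrite !mxE (enorm_grad_radial Du) -/w big_ord1 !mxE.
have sw : Num.sqrt w != 0 by rewrite gt_eqF// sqrtr_gt0.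
have -> : \sum_(k < n) ((i == k)%:R + pderiv i u x * pderiv k u x / w) *
    pderiv k (pderiv j u) x =
  \sum_(k < n) (i == k)%:R * (a * (j == k)%:R + b * x 0 j * x 0 k) +
  \sum_(k < n) (a ^+ 3 / w * x 0 i * x 0 k * (j == k)%:R +
     a ^+ 2 * b / w * x 0 i * x 0 j * x 0 k ^+ 2).
  rewrite -big_split/=; apply: eq_bigr => k _; rewrite D2u !Du; ring.
have delta (k : 'I_n) (F : 'I_n -> R) : \sum_(l < n) (k == l)%:R * F l = F k.
  rewrite (bigD1 k)//= eqxx mul1r big1 ?addr0// => l /negbTE.
  by rewrite eq_sym => ->; rewrite mul0r.
rewrite delta big_split/= -mulr_sumr -/(sqnorm x).
have -> : \sum_(k < n) a ^+ 3 / w * x 0 i * x 0 k * (j == k)%:R =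
    a ^+ 3 / w * x 0 i * x 0 j.
  by under eq_bigr do rewrite mulrC; rewrite delta.
move: (Num.sqrt w) sw => q q0; rewrite /w in w0 *.
by rewrite [j == i]eq_sym; case: (i == j); rewrite ?mulr1n ?mulr0n; field;
  rewrite q0 gt_eqF.
Qed.

(** The principal curvatures of a rotationally symmetric graph: one in the
    radial direction and another, repeated, in the directions orthogonal to
    it. *)
Lemma mean_curvatures_radial u x (a b : R) : (0 < m)%N ->
  0 < 1 - a ^+ 2 * sqnorm x ->
  (forall i, pderiv i u x = a * x 0 i) ->
  (forall j k, pderiv k (pderiv j u) x =
     a * (j == k)%:R + b * x 0 j * x 0 k) ->
  let w := 1 - a ^+ 2 * sqnorm x in
  let lt := a / Num.sqrt w in
  let lr := (a + sqnorm x * b) / (w * Num.sqrt w) in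
  mean_curvature 1 u x = (m.+1%:R * lt + lr) / n%:R /\
  mean_curvature 2 u x = (m%:R * lt ^+ 2 + 2 * (lt * lr)) / n%:R.
Proof.
move=> m0 w0 Du D2u w lt lr; apply: mean_curvatures => //.
rewrite (shape_operator_radial w0 Du D2u) char_poly_rank1 -/w -/(sqnorm x).
congr (_ * ('X - _%:P)); rewrite /lr.
have : Num.sqrt w != 0 by rewrite gt_eqF// sqrtr_gt0.
move: (Num.sqrt w) => q q0; rewrite /w; field.
by rewrite q0 gt_eqF.
Qed.

End RadialCurvatures.

Section RadialRegularity.
Variables (R : realType) (n : nat) (U M N : R -> R).
Implicit Types x : 'rV[R]_n.
Hypothesis DU : forall s : R, 0 <= s -> is_derive s 1 U (M s / 2).
Hypothesis M_cont : continuous M.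
Hypothesis DM : forall s : R, 0 < s -> is_derive s 1 M (N s / 2).
Hypothesis N_cont : forall s : R, 0 < s -> {for s, continuous N}.
Hypothesis N_near0 : s * N s @[s --> 0^'+] --> 0.

Let u x := U (sqnorm x).

Lemma is_derive_u i x : is_derive x (delta_mx 0 i) u (M (sqnorm x) * x 0 i).
Proof. by apply: is_derive_radial; apply: DU; exact: sqnorm_ge0. Qed.

Lemma pderiv_u i : pderiv i u = fun x => M (sqnorm x) * x 0 i.
Proof. by apply/funext => x; have [_] := is_derive_u i x. Qed.

Lemma is_derive2_u i j x : is_derive x (delta_mx 0 j) (pderiv i u)
  (M (sqnorm x) * (i == j)%:R + N (sqnorm x) * x 0 i * x 0 j).
Proof.
rewrite pderiv_u; have [->|x0] := eqVneq x 0.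
  rewrite sqnorm0 !mxE mulr0 addr0; apply: is_derive_radial_field0.
  exact: M_cont.
by apply: is_derive_radial_field; apply: DM; rewrite sqnorm_gt0.
Qed.

Lemma pderiv2_u i j : pderiv j (pderiv i u) =
  fun x => M (sqnorm x) * (i == j)%:R + N (sqnorm x) * x 0 i * x 0 j.
Proof. by apply/funext => x; have [_] := is_derive2_u i j x. Qed.

Lemma continuous_Msqnorm : continuous (fun x => M (sqnorm x)).
Proof.
by move=> x; apply: continuous_comp; [exact: continuous_sqnorm|exact: M_cont].
Qed.

(** The second derivatives contain [N (sqnorm x) * x 0 i * x 0 j], which is
    bounded by [s * N s] at [s = sqnorm x] and so vanishes at the origin even if
    [N] is singular there. *)
Lemma classC2_radial : classC 2 u.
Proof.
split.
  move=> x; apply: continuous_comp; first exact: continuous_sqnorm.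
  exact: is_derive_continuous (DU (sqnorm_ge0 x)).
move=> i; split; first by move=> x; have [] := is_derive_u i x.
split.
  rewrite pderiv_u => x; apply: continuous_mulfun.
    exact: continuous_Msqnorm.
  exact: continuous_coord.
move=> j; split; first by move=> x; have [] := is_derive2_u i j x.
split=> //; rewrite pderiv2_u => x; apply: (@continuous_addfun R 'rV[R]_n
    (fun y => M (sqnorm y) * (i == j)%:R)
    (fun y => N (sqnorm y) * y 0 i * y 0 j)).
  by apply: continuous_mulfun; [exact: continuous_Msqnorm|exact: cst_continuous].
have [->|x0] := eqVneq x 0; last first.
  apply: continuous_mulfun; last exact: continuous_coord.
  apply: continuous_mulfun; last exact: continuous_coord.
  apply: continuous_comp; first exact: continuous_sqnorm.
  by apply: N_cont; rewrite sqnorm_gt0.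
apply: continuous_at_zero => [|e e0]; first by rewrite !mxE mulr0.
have /cvgr0Pnorm_le/(_ _ e0)[d /= d0 Hd] := N_near0.
have /cvgrPdist_lt/(_ _ d0) := @continuous_sqnorm R n 0.
rewrite sqnorm0 => near0; near=> y.
have yd : `|0 - sqnorm y| < d by near: y; exact: near0.
have [->|y0] := eqVneq y 0; first by rewrite !mxE !mulr0 normr0 ltW.
have sy : 0 < sqnorm y by rewrite sqnorm_gt0.
apply: le_trans (Hd _ yd sy).
rewrite -mulrA [in leRHS]mulrC !normrM ler_wpM2l// [leRHS]gtr0_norm//.
have := sqr_coord_le y i; have := sqr_coord_le y j.
rewrite -[X in X <= _ -> _](@real_normK _ (y 0 j)) ?num_real//.
rewrite -[X in _ -> X <= _ -> _](@real_normK _ (y 0 i)) ?num_real//.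
move=> yj yi; have := sqr_ge0 (`|y 0 i| - `|y 0 j|); rewrite sqrrB; lra.
Unshelve. all: by end_near. Qed.

End RadialRegularity.

(** * Strict convexity of radial functions *)

Section StrictConvexity.
Variable R : realType.

Lemma sum_mul_le_enorm n (x y : 'rV[R]_n) :
  \sum_(i < n) x 0 i * y 0 i <= enorm x * enorm y.
Proof.
set a := enorm x; set b := enorm y; set p := \sum_(i < n) _.
have a0 : 0 <= a := enorm_ge0 x; have b0 : 0 <= b := enorm_ge0 y.
have : 0 <= \sum_(i < n) (b * x 0 i - a * y 0 i) ^+ 2.
  by apply: sumr_ge0 => i _; exact: sqr_ge0.
have -> : \sum_(i < n) (b * x 0 i - a * y 0 i) ^+ 2 =
    b ^+ 2 * sqnorm x + a ^+ 2 * sqnorm y - 2 * (a * b) * p.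
  rewrite /sqnorm /p !mulr_sumr -sumrN -!big_split/=.
  by apply: eq_bigr => i _; ring.
rewrite -!enorm_sqr -/a -/b => H.
have [ab0|] := eqVneq (a * b) 0; last first.
  move=> ab; have ab0 : 0 < a * b by rewrite lt_def ab mulr_ge0.
  rewrite -subr_ge0 -(pmulr_rge0 _ ab0).
  by move: H; rewrite (_ : _ - _ = 2 * (a * b * (a * b - p))); [lra|ring].
suff : p = 0 by move=> ->; rewrite mulr_ge0.
have z (v : 'rV[R]_n) : enorm v = 0 -> v = 0.
  by move=> v0; apply/eqP; rewrite -sqnorm_eq0 -enorm_sqr v0 expr0n.
move/eqP: ab0; rewrite mulf_eq0 => /orP[] /eqP/z v0;
  by rewrite /p v0 big1// => i _; rewrite mxE ?mul0r ?mulr0.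
Qed.

Lemma sqnorm_convex n (x y : 'rV[R]_n) (t : R) :
  sqnorm (t *: x + (1 - t) *: y) =
  t ^+ 2 * sqnorm x + (1 - t) ^+ 2 * sqnorm y +
    2 * (t * (1 - t)) * \sum_(i < n) x 0 i * y 0 i.
Proof.
rewrite /sqnorm !mulr_sumr -!big_split/=; apply: eq_bigr => i _.
by rewrite !mxE; ring.
Qed.

Lemma sqnormB n (x y : 'rV[R]_n) :
  sqnorm (x - y) = sqnorm x + sqnorm y - 2 * \sum_(i < n) x 0 i * y 0 i.
Proof.
rewrite /sqnorm !mulr_sumr -sumrN -!big_split/=; apply: eq_bigr => i _.
by rewrite !mxE; ring.
Qed.

Variables (f df : R -> R).
Hypothesis Df : forall r : R, 0 <= r -> is_derive r 1 f (df r).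
Hypothesis df_incr : forall r s, 0 <= r -> r < s -> df r < df s.
Hypothesis df0 : df 0 = 0.

Let f_incr (r s : R) : 0 <= r -> r < s -> f r < f s.
Proof.
move=> r0 rs; apply: (@lt_of_derive _ f df) => //.
- by apply: (@within_continuous_derive _ f df) => x /andP[rx _]; apply: Df; lra.
- by move=> x /andP[rx _]; apply: Df; lra.
- by move=> x /andP[rx _]; rewrite -df0; apply: df_incr; lra.
Qed.

Let f_convex (a b t : R) : 0 <= a -> a < b -> 0 < t < 1 ->
  f (t * a + (1 - t) * b) < t * f a + (1 - t) * f b.
Proof.
move=> a0 ab /andP[t0 t1]; set c := t * a + _.
have s0 : 0 < 1 - t by lra.
have ba : 0 < b - a by lra.
have ca : c - a = (1 - t) * (b - a) by rewrite /c; ring.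
have bc : b - c = t * (b - a) by rewrite /c; ring.
have ac : a < c by rewrite -subr_gt0 ca mulr_gt0.
have cb : c < b by rewrite -subr_gt0 bc mulr_gt0.
have cont (r s : R) : 0 <= r -> {within `[r, s], continuous f}.
  move=> r0; apply: (@within_continuous_derive _ f df) => x /andP[rx _].
  by apply: Df; lra.
have D (r s : R) : 0 <= r -> forall x : R, x \in `]r, s[ -> is_derive x 1 f (df x).
  by move=> r0 x; rewrite in_itv/= => /andP[rx _]; apply: Df; lra.
have [x + xE] := MVT ac (D _ _ a0) (cont _ _ a0).
have c0 : 0 <= c by lra.
have [y + yE] := MVT cb (D _ _ c0) (cont _ _ c0).
rewrite !in_itv/= => /andP[cy yb] /andP[ax xc].
rewrite ca in xE; rewrite bc in yE.
have x0 : 0 <= x by lra.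
have xy := df_incr x0 (lt_trans xc cy).
rewrite -subr_gt0.
have -> : t * f a + (1 - t) * f b - f c =
    (1 - t) * (f b - f c) - t * (f c - f a) by ring.
rewrite xE yE.
have -> : (1 - t) * (df y * (t * (b - a))) - t * (df x * ((1 - t) * (b - a))) =
    (1 - t) * t * (b - a) * (df y - df x) by ring.
by rewrite !mulr_gt0// subr_gt0.
Qed.

(** If [enorm x = enorm y] the strictness comes from that of the Euclidean
    ball, and otherwise from that of [f]. *)
Lemma strictly_convex_radial n : strictly_convex (fun x : 'rV[R]_n => f (enorm x)).
Proof.
move=> x y t xy t01; have /andP[t0 t1] := t01; have s0 : 0 < 1 - t by lra.
set z := t *: x + _; have z0 := enorm_ge0 z.
have x0 := enorm_ge0 x; have y0 := enorm_ge0 y.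
have [exy|nxy] := eqVneq (enorm x) (enorm y).
  have -> : t * f (enorm x) + (1 - t) * f (enorm y) = f (enorm x).
    by rewrite exy; ring.
  apply: f_incr => //.
  have : 0 < t * (1 - t) * sqnorm (x - y).
    by rewrite !mulr_gt0// sqnorm_gt0 subr_eq0.
  have -> : t * (1 - t) * sqnorm (x - y) = sqnorm x - sqnorm z.
    rewrite /z sqnormB sqnorm_convex -[sqnorm y]enorm_sqr -exy enorm_sqr.
    by ring.
  by rewrite subr_gt0 -!enorm_sqr ltr_pXn2r ?nnegrE.
have zc : enorm z <= t * enorm x + (1 - t) * enorm y.
  have c0 : 0 <= t * enorm x + (1 - t) * enorm y.
    by apply: addr_ge0; apply: mulr_ge0 => //; exact: ltW.
  rewrite -(@ler_pXn2r _ 2) ?nnegrE// enorm_sqr sqnorm_convex.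
  have -> : (t * enorm x + (1 - t) * enorm y) ^+ 2 =
    t ^+ 2 * enorm x ^+ 2 + (1 - t) ^+ 2 * enorm y ^+ 2 +
      2 * (t * (1 - t)) * (enorm x * enorm y) by ring.
  rewrite !enorm_sqr lerD2l ler_wpM2l ?sum_mul_le_enorm//.
  by rewrite !mulr_ge0 ?ltW.
apply: (@le_lt_trans _ _ (f (t * enorm x + (1 - t) * enorm y))).
  by move: zc; rewrite le_eqVlt => /orP[/eqP->//|/(f_incr z0)/ltW].
case: (ltgtP (enorm x) (enorm y)) nxy => // lt _; first exact: f_convex.
have st : 0 < 1 - t < 1 by lra.
have := f_convex y0 lt st; rewrite subKr ![(1 - t) * _ + _]addrC; lra.
Qed.

End StrictConvexity.

(** * The radial equation: Picard iteration *)

Section Picard.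
Variables (R : realType) (m : nat) (C : R) (h : R -> R).
Hypotheses (m_gt0 : (0 < m)%N) (h_cont : continuous h).
Hypotheses (h_ge0 : forall r, 0 <= h r) (h_le : forall r, h r <= C).
Implicit Types (G T : R -> R) (r : R).

(** The truncated square root of the second mean curvature prescribed at radius
    [r] when [G] is the square of the tilt [f' / sqrt (1 - f'^2)]; truncating
    makes it bounded, and the absolute value makes it Lipschitz on all of
    [R]. *)
Definition root_curv r (x : R) : R := Num.max 0 (h r - Num.sqrt (1 + `|x|)).

Lemma C_ge0 : 0 <= C. Proof. exact: le_trans (h_ge0 0) (h_le 0). Qed.

Lemma root_curv_ge0 r x : 0 <= root_curv r x.
Proof. by rewrite le_max lexx. Qed.

Lemma root_curv_le r x : root_curv r x <= C.
Proof.
rewrite ge_max C_ge0 lerBlDr (le_trans (h_le r))// lerDl.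
exact: sqrtr_ge0.
Qed.

Lemma continuous_root_curv G :
  continuous G -> continuous (fun r => root_curv r (G r)).
Proof.
move=> cG r.
apply: (@continuous_max R R (cst 0) (fun s => h s - Num.sqrt (1 + `|G s|))).
  exact: cvg_cst.
apply: cvgB; first exact: h_cont.
apply: continuous_comp; last exact: sqrt_continuous.
apply: cvgD; first exact: cvg_cst.
by apply: cvg_norm; exact: cG.
Qed.

Lemma sqrt1_lipschitz (x y : R) : 0 <= x -> 0 <= y ->
  2 * `|Num.sqrt (1 + x) - Num.sqrt (1 + y)| <= `|x - y|.
Proof.
move=> x0 y0.
have sx : 1 <= Num.sqrt (1 + x) by rewrite -[leLHS]sqrtr1 ler_wsqrtr// lerDl.
have sy : 1 <= Num.sqrt (1 + y) by rewrite -[leLHS]sqrtr1 ler_wsqrtr// lerDl.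
have -> : x - y = (Num.sqrt (1 + x) + Num.sqrt (1 + y)) *
    (Num.sqrt (1 + x) - Num.sqrt (1 + y)).
  rewrite mulrC -subr_sqr !sqr_sqrtr ?addr_ge0//; ring.
rewrite normrM ler_wpM2r// ger0_norm; lra.
Qed.

Lemma root_curv_lipschitz r (x y : R) :
  `|root_curv r x ^+ 2 - root_curv r y ^+ 2| <= C * `|x - y|.
Proof.
have d : 2 * `|root_curv r x - root_curv r y| <= `|x - y|.
  apply: le_trans (ler_dist_dist x y).
  apply: le_trans (sqrt1_lipschitz (normr_ge0 x) (normr_ge0 y)).
  rewrite ler_pM2l//.
  rewrite /root_curv; case: (leP 0 (h r - Num.sqrt (1 + `|x|)));
    case: (leP 0 (h r - Num.sqrt (1 + `|y|))); move=> b a.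
  - rewrite [leLHS]distrC opprB.
    by have -> : h r - Num.sqrt (1 + `|y|) + (Num.sqrt (1 + `|x|) - h r) =
      Num.sqrt (1 + `|x|) - Num.sqrt (1 + `|y|) by ring.
  - by rewrite subr0 [leLHS]ger0_norm// ler_normr; apply/orP; right; lra.
  - by rewrite sub0r normrN [leLHS]ger0_norm// ler_normr; apply/orP; left; lra.
  - by rewrite subrr normr0.
rewrite subr_sqr normrM mulrC.
have s0 := root_curv_ge0 r x; have t0 := root_curv_ge0 r y.
have s1 := root_curv_le r x; have t1 := root_curv_le r y.
rewrite [X in X * _]ger0_norm ?addr_ge0//.
apply: (@le_trans _ _ (2 * C * `|root_curv r x - root_curv r y|)).
  by rewrite ler_wpM2r//; lra.
by rewrite [2 * C]mulrC -mulrA ler_wpM2l// C_ge0.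
Qed.

(** What one step of the iteration provides: [r ^+ m * T r] is the primitive,
    vanishing at 0, of the right-hand side evaluated along [G]. *)
Definition picard_image G T :=
  [/\ continuous T, forall r, T `|r| = T r,
      forall r, 0 <= T r <= C ^+ 2 * r ^+ 2 &
      forall r, 0 < r -> is_derive r 1 (fun s : R => s ^+ m * T s)
        (m.+2%:R * r ^+ m.+1 * root_curv r (G r) ^+ 2)].

Lemma is_derive_power (a : R) k r :
  is_derive r 1 (fun s : R => a * s ^+ k.+1) (a * (k.+1%:R * r ^+ k)).
Proof.
have := is_derive_mulfun (is_derive_cstfun a r 1)
  (is_derive_expfun k.+1 (is_derive_idfun r)).
by rewrite /= mulr0 addr0 mulr1.
Qed.

Lemma continuous_power (a : R) k : continuous (fun s : R => a * s ^+ k).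
Proof. by move=> r; apply: cvgMr; exact: exprn_continuous. Qed.

Lemma picard_step G : continuous G -> exists T, picard_image G T.
Proof.
move=> cG.
pose f r := m.+2%:R * r ^+ m.+1 * root_curv r (G r) ^+ 2.
have cf : continuous f.
  move=> r; apply: cvgM; first exact: continuous_power.
  apply: (@continuous_comp _ _ _ (fun s => root_curv s (G s)) (fun t => t ^+ 2)).
    exact: continuous_root_curv.
  exact: exprn_continuous.
have [Q [Q0 DQ]] := exists_primitive cf.
have Dq r : 0 <= r -> is_derive r 1 Q (f r).
  by move=> r0; apply: DQ; lra.
have cQ r : 0 <= r -> {for r, continuous Q}.
  by move=> /Dq; exact: is_derive_continuous.
have Q_le r : 0 <= r -> `|Q r| <= C ^+ 2 * r ^+ m.+2.
  move=> r0; apply: (@norm_le_of_derive _ Q (fun r => C ^+ 2 * r ^+ m.+2)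
    f (fun r => C ^+ 2 * (m.+2%:R * r ^+ m.+1))) => //.
  - by move=> x _; exact: continuous_power.
  - by move=> x /andP[/ltW x0 _]; exact: Dq.
  - by move=> x _; exact: is_derive_power.
  - move=> x /andP[/ltW x0 _]; rewrite /f normrM ger0_norm; last first.
      by rewrite mulr_ge0// exprn_ge0.
    rewrite [leRHS]mulrC ler_wpM2l ?mulr_ge0 ?exprn_ge0//.
    rewrite ger0_norm ?exprn_ge0 ?root_curv_ge0//.
    by rewrite lerXn2r ?nnegrE ?C_ge0 ?root_curv_ge0 ?root_curv_le.
  - by rewrite expr0n mulr0.
have Q_ge0 r : 0 <= r -> 0 <= Q r.
  move=> r0; rewrite -Q0; apply: (@le_of_derive _ Q f) => //.
  - by apply: within_continuous_for => x /andP[x0 _]; exact: cQ.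
  - by move=> x /andP[/ltW x0 _]; exact: Dq.
  - by move=> x /andP[/ltW x0 _]; rewrite /f !mulr_ge0 ?exprn_ge0 ?root_curv_ge0.
pose T r := Q `|r| / `|r| ^+ m.
have T_bnd r : 0 <= T r <= C ^+ 2 * r ^+ 2.
  rewrite divr_ge0 ?Q_ge0 ?exprn_ge0//=.
  have [->|r0] := eqVneq r 0; first by rewrite /T normr0 Q0 mul0r expr0n mulr0.
  rewrite ler_pdivrMr ?exprn_gt0 ?normr_gt0// -[r ^+ 2]real_normK ?num_real//.
  rewrite -mulrA -exprD add2n (le_trans (ler_norm _))//.
  exact: Q_le.
exists T; split => //.
- move=> r; have [->|r0] := eqVneq r 0; last first.
    apply: cvgM.
      apply: continuous_comp; first exact: norm_continuous.
      by apply: cQ.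
    apply: cvgV; first by rewrite expf_neq0// normr_eq0.
    apply: (@continuous_comp _ _ _ (fun s : R => `|s|) (fun t => t ^+ m)).
      exact: norm_continuous.
    exact: exprn_continuous.
  have T0 : T 0 = 0 by rewrite /T normr0 Q0 mul0r.
  rewrite /continuous_at T0; apply: (@squeeze_cvgr _ _ _ _ (cst 0)
    (fun r : R => C ^+ 2 * r ^+ 2)); first by near=> s; exact: T_bnd.
    exact: cvg_cst.
  rewrite [X in _ --> X](_ : 0 = C ^+ 2 * 0 ^+ 2); last by rewrite expr0n mulr0.
  exact: continuous_power.
- by move=> r; rewrite /T normr_id.
- move=> r r0; apply: (@is_derive_near _ Q); last exact/Dq/ltW.
  near=> s; have s0 : 0 < s by near: s; exact: lt_nbhsr.
  by rewrite /T gtr0_norm// mulrC divfK// expf_neq0// gt_eqF.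
Unshelve. all: by end_near. Qed.

(** The contraction estimate: the two powers of [r] gained at each step are
    what makes the iterates converge factorially fast. *)
Lemma picard_diff G1 G2 T1 T2 (A b : R) j : 0 <= A ->
  picard_image G1 T1 -> picard_image G2 T2 ->
  (forall r, `|r| <= b -> `|G1 r - G2 r| <= A * `|r| ^+ j) ->
  forall r, `|r| <= b ->
    `|T1 r - T2 r| <= m.+2%:R * C * A / (m.+2 + j)%:R * `|r| ^+ j.+2.
Proof.
move=> A0 [cT1 T1n T1b D1] [cT2 T2n T2b D2] dG r.
rewrite -T1n -T2n; move: `|r| (normr_ge0 r) => {}r r0 rb.
have [->|rn0] := eqVneq r 0.
  have T0 T : (forall s, 0 <= T s <= C ^+ 2 * s ^+ 2) -> T 0 = 0.
    by move=> /(_ 0); rewrite expr0n mulr0 -eq_le => /eqP.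
  by rewrite (T0 T1)// (T0 T2)// subrr normr0 expr0n mulr0.
have {}r0 : 0 < r by rewrite lt_def rn0.
rewrite -(ler_pM2l (exprn_gt0 m r0)).
rewrite -[X in X * _ <= _](ger0_norm (exprn_ge0 m (ltW r0))) -normrM mulrBr.
have -> : r ^+ m * (m.+2%:R * C * A / (m.+2 + j)%:R * r ^+ j.+2) =
    m.+2%:R * C * A / (m.+2 + j)%:R * r ^+ (m.+1 + j).+1.
  by rewrite mulrCA -exprD; congr (_ * _ ^+ _); rewrite !addnS.
apply: (@norm_le_of_derive _ (fun s => s ^+ m * T1 s - s ^+ m * T2 s)
  (fun s => m.+2%:R * C * A / (m.+2 + j)%:R * s ^+ (m.+1 + j).+1)
  (fun s => m.+2%:R * s ^+ m.+1 * root_curv s (G1 s) ^+ 2 -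
            m.+2%:R * s ^+ m.+1 * root_curv s (G2 s) ^+ 2)
  (fun s => m.+2%:R * C * A / (m.+2 + j)%:R *
      ((m.+1 + j).+1%:R * s ^+ (m.+1 + j)))) => //.
- exact: ltW.
- by move=> x _; apply: cvgB; (apply: cvgM; first exact: exprn_continuous);
    [exact: cT1|exact: cT2].
- by move=> x _; exact: continuous_power.
- by move=> x /andP[x0 _]; apply: is_derive_subfun; [exact: D1|exact: D2].
- by move=> x _; exact: is_derive_power.
- move=> x /andP[x0 xr]; rewrite -mulrBr normrM ger0_norm; last first.
    by rewrite mulr_ge0// exprn_ge0// ltW.
  have -> : m.+2%:R * C * A / (m.+2 + j)%:R *
    ((m.+1 + j).+1%:R * x ^+ (m.+1 + j)) =
    m.+2%:R * x ^+ m.+1 * (C * (A * x ^+ j)).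
    have c0 : (m.+2 + j)%:R != 0 :> R by rewrite pnatr_eq0.
    by rewrite [_ / _ * _]mulrA (divfK c0) exprD; ring.
  rewrite ler_wpM2l ?mulr_ge0 ?exprn_ge0 ?(ltW x0)//.
  apply: le_trans (root_curv_lipschitz _ _ _) _; rewrite ler_wpM2l ?C_ge0//.
  have := dG x; rewrite gtr0_norm//; apply.
  by rewrite (le_trans (ltW xr)).
- by rewrite expr0n eqn0Ngt m_gt0 /= !mul0r subrr.
- by rewrite expr0n mulr0.
Qed.

(** The iterates converge locally uniformly, so their limit is continuous and
    is its own image. *)
Lemma exists_squared_tilt : exists G, picard_image G G.
Proof.
have [S HS] : {S : (R -> R) -> R -> R &
    forall G, continuous G -> picard_image G (S G)}.
  apply: (@boolp.choice _ _ (fun G T => continuous G -> picard_image G T)) => G.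
  have [/picard_step[T HT]|nG] := pselect (continuous G); first by exists T.
  by exists G.
pose g k := iter k S (fun=> 0).
have g_cont k : continuous (g k).
  elim: k => [|k IH]; first by move=> r; exact: cvg_cst.
  by have [] := HS _ IH.
have g_im k : picard_image (g k) (g k.+1) by exact: HS.
pose l := m.+2%:R * C.
have l0 : 0 <= l by rewrite mulr_ge0// C_ge0.
have g_diff k r :
    `|g k.+1 r - g k r| <= C ^+ 2 * r ^+ 2 * exp_coeff (l * r ^+ 2) k.
  suff H : `|g k.+1 r - g k r| <= C ^+ 2 * l ^+ k / k`!%:R * `|r| ^+ k.*2.+2.
    apply: le_trans H _; rewrite /exp_coeff /= [(l * _) ^+ k]exprMn.
    rewrite -[r ^+ 2]real_normK ?num_real// -exprM mul2n -[k.*2.+2]addn2 exprD.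
    rewrite le_eqVlt; apply/orP; left; apply/eqP.
    by move: (`|r| ^+ k.*2) (l ^+ k) (k`!%:R^-1) => x y z; ring.
  elim: k r => [|k IH] r.
    rewrite /= expr0 fact0 divr1 mulr1 subr0 real_normK ?num_real//.
    have [_ _ /(_ r)/andP[a b] _] := g_im 0%N.
    by rewrite ger0_norm.
  have A0 : 0 <= C ^+ 2 * l ^+ k / k`!%:R.
    by rewrite divr_ge0// mulr_ge0 ?exprn_ge0// C_ge0.
  have := picard_diff A0 (g_im k.+1) (g_im k) (fun r _ => IH r) (lexx `|r|).
  move/le_trans; apply; rewrite doubleS ler_wpM2r ?exprn_ge0//.
  rewrite [l ^+ k.+1]exprS factS natrM -/l.
  have -> : C ^+ 2 * (l * l ^+ k) / (k.+1%:R * k`!%:R) =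
      l * (C ^+ 2 * l ^+ k / k`!%:R) / k.+1%:R.
    by rewrite invfM; ring.
  rewrite ler_wpM2l ?(mulr_ge0 l0)// lef_pV2 ?posrE ?ltr0n//.
  by rewrite ler_nat -addnn (leq_trans _ (leq_addl _ _))// ltnS ltnW// ltnS leq_addr.
(* On |r| <= b the increments are dominated by a convergent series. *)
pose B b := [series C ^+ 2 * b ^+ 2 * exp_coeff (l * b ^+ 2) k]_k : R^nat.
have B_cvg b : cvgn (B b).
  rewrite /B; have := is_cvg_series_exp_coeff (l * b ^+ 2) => /is_cvg_seriesZ.
  exact.
have g_B b k p r : `|r| <= b -> `|g (k + p)%N r - g k r| <= B b (k + p)%N - B b k.
  move=> rb; elim: p => [|p IH]; first by rewrite addn0 !subrr normr0.
  rewrite addnS; have -> : g (k + p).+1 r - g k r =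
    (g (k + p).+1 r - g (k + p)%N r) + (g (k + p)%N r - g k r) by ring.
  apply: le_trans (ler_normD _ _) _.
  have -> : B b (k + p).+1 - B b k =
     C ^+ 2 * b ^+ 2 * exp_coeff (l * b ^+ 2) (k + p)%N + (B b (k + p)%N - B b k).
    by rewrite /B /series/= big_nat_recr//=; ring.
  apply: lerD IH; apply: le_trans (g_diff _ _) _.
  have r2 : r ^+ 2 <= b ^+ 2.
    rewrite -[r ^+ 2]real_normK ?num_real// lerXn2r ?nnegrE//.
    exact: le_trans rb.
  apply: ler_pM; first by rewrite mulr_ge0 ?sqr_ge0.
  - by rewrite exp_coeff_ge0// mulr_ge0 ?sqr_ge0.
  - by rewrite ler_wpM2l// sqr_ge0.
  - rewrite /exp_coeff/= ler_wpM2r ?invr_ge0//.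
    rewrite lerXn2r ?nnegrE ?(mulr_ge0 l0 (sqr_ge0 _))//.
    by rewrite ler_wpM2l.
pose e b k := limn (B b) - B b k.
have e_cvg b : e b @ \oo --> 0.
  rewrite -(subrr (limn (B b))); apply: cvgB; first exact: cvg_cst.
  exact: B_cvg.
have B_e b k l' : (k <= l')%N -> B b l' - B b k <= e b k.
  move=> kl; rewrite lerD2r; apply: nondecreasing_cvgn_le (B_cvg b) _.
  apply: nondecreasing_series => i _ _.
  apply: mulr_ge0; first by rewrite mulr_ge0 ?sqr_ge0.
  by rewrite exp_coeff_ge0// (mulr_ge0 l0 (sqr_ge0 _)).
have g_e b k p r : `|r| <= b -> (k <= p)%N -> `|g p r - g k r| <= e b k.
  move=> rb kp; rewrite -(subnKC kp); apply: le_trans (g_B _ _ _ _ rb) _.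
  by apply: B_e; rewrite leq_addr.
have g_cvg r : cvgn (fun k => g k r).
  apply/cauchy_cvgP/cauchy_exP => eps eps0.
  have /cvgr0Pnorm_lt/(_ _ eps0)[k _ /(_ k (leqnn k)) ek] := e_cvg `|r|.
  exists (g k r); exists k => // p /= kp.
  rewrite /ball/= distrC; apply: le_lt_trans (g_e `|r| k p r (lexx _) kp) _.
  exact: le_lt_trans (ler_norm _) ek.
pose G r := limn (fun k => g k r).
have G_e b k r : `|r| <= b -> `|G r - g k r| <= e b k.
  move=> rb.
  have c : `|g p r - g k r| @[p --> \oo] --> `|G r - g k r|.
    by apply: cvg_norm; apply: cvgB; [exact: g_cvg|exact: cvg_cst].
  rewrite -(cvg_lim _ c)//; apply: limr_le.
    by apply/cvg_ex; exists `|G r - g k r|.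
  by exists k => // p /= kp; exact: g_e.
have G_lim r : g k r @[k --> \oo] --> G r by exact: g_cvg.
have G_cont : continuous G.
  move=> r; apply/cvgrPdist_lt => eps eps0.
  have eps3 : 0 < eps / 3 by rewrite divr_gt0.
  have /cvgr0Pnorm_lt/(_ _ eps3)[k _ /(_ k (leqnn k)) ek] := e_cvg (`|r| + 1).
  have {}ek := le_lt_trans (ler_norm _) ek.
  have /cvgrPdist_lt/(_ _ eps3) gk := g_cont k r.
  have /cvgrPdist_lt/(_ _ ltr01) near1 : s @[s --> r] --> r by exact: cvg_id.
  near=> s.
  have sb : `|s| <= `|r| + 1.
    have rs : `|r - s| < 1 by near: s; exact: near1.
    rewrite -[X in `|X| <= _](subKr r); apply: le_trans (ler_normB _ _) _.
    by rewrite lerD2l ltW.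
  have rb : `|r| <= `|r| + 1 by rewrite lerDl.
  have -> : G r - G s = (G r - g k r) + (g k r - g k s) - (G s - g k s) by ring.
  apply: le_lt_trans (ler_normB _ _) _.
  have := le_lt_trans (G_e _ k _ rb) ek; have := le_lt_trans (G_e _ k _ sb) ek.
  have : `|g k r - g k s| < eps / 3 by near: s; exact: gk.
  have := ler_normD (G r - g k r) (g k r - g k s); lra.
exists G; have im := HS _ G_cont.
suff SG : S G = G by move: (im); rewrite SG.
apply/funext => r; apply/eqP; rewrite -subr_eq0 -normr_le0.
pose d k := C * (e `|r| k) * `|r| ^+ 2 + e `|r| k.+1.
have d0 : d @ \oo --> 0.
  rewrite [X in _ --> X](_ : _ = C * 0 * `|r| ^+ 2 + 0);
    last by rewrite mulr0 mul0r addr0.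
  apply: cvgD; first by apply: cvgMl; apply: cvgMr.
  by rewrite (cvg_shiftS (e `|r|)); exact: e_cvg.
rewrite -(cvg_lim _ d0)//; apply: limr_ge; first by apply/cvg_ex; exists 0.
near=> k.
have -> : S G r - G r = (S G r - g k.+1 r) - (G r - g k.+1 r) by ring.
apply: le_trans (ler_normB _ _) _; apply: lerD; last exact: G_e.
have e0 : 0 <= e `|r| k by apply: le_trans (G_e _ k r (lexx _)).
have Hd s : `|s| <= `|r| -> `|G s - g k s| <= e `|r| k * `|s| ^+ 0.
  by rewrite expr0 mulr1; exact: G_e.
have := picard_diff e0 im (g_im k) Hd (lexx _).
by rewrite addn0 -[_ * C * _]mulrA [X in X / _]mulrC mulfK ?pnatr_eq0.
Unshelve. all: by end_near. Qed.

End Picard.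

(** * The radial equation: monotonicity and behaviour at infinity *)

(** The radial principal curvature vanishes exactly where the square root of
    the second mean curvature is [tilt_ratio R m] times the tangential
    curvature. *)
Definition tilt_ratio (R : realType) (m : nat) : R := Num.sqrt (m%:R / m.+2%:R).

Section Profile.
Variables (R : realType) (m : nat) (C : R) (h : R -> R) (G : R -> R).
Hypotheses (m_gt0 : (0 < m)%N) (h_cont : continuous h).
Hypotheses (h_gt1 : forall r, 1 < h r) (h_le : forall r, h r <= C).
Hypothesis h_mono : forall r s, 0 <= r -> r <= s -> h r <= h s.
Hypothesis G_fix : picard_image m C h G G.
Implicit Types r s : R.

Local Notation kappa := (tilt_ratio R m).

Lemma kappa_sqr : kappa ^+ 2 = m%:R / m.+2%:R.
Proof. by rewrite sqr_sqrtr// divr_ge0. Qed.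

Lemma kappa_gt0 : 0 < kappa.
Proof. by rewrite sqrtr_gt0 divr_gt0 ?ltr0n. Qed.

Lemma kappa_lt1 : kappa < 1.
Proof.
rewrite -[ltRHS]sqrtr1 ltr_sqrt// ltr_pdivrMr ?ltr0n// mul1r ltr_nat.
by rewrite ltnS leqnSn.
Qed.

Lemma continuous_G : continuous G. Proof. by case: G_fix. Qed.

Lemma G_ge0 r : 0 <= G r.
Proof. by case: G_fix => _ _ /(_ r)/andP[]. Qed.

Lemma G_at0 : G 0 = 0.
Proof.
by case: G_fix => _ _ /(_ 0) + _; rewrite expr0n mulr0 -eq_le => /eqP.
Qed.

Lemma is_derive_weighted r : 0 < r ->
  is_derive r 1 (fun s => s ^+ m * G s)
    (m.+2%:R * r ^+ m.+1 * root_curv h r (G r) ^+ 2).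
Proof. by case: G_fix => _ _ _; exact. Qed.

Lemma is_derive_G r : 0 < r -> is_derive r 1 G
  (m.+2%:R * r * (root_curv h r (G r) ^+ 2 - kappa ^+ 2 * (G r / r ^+ 2))).
Proof.
move=> r0; have rm : r ^+ m != 0 by rewrite expf_neq0// gt_eqF.
have := is_derive_mulfun (is_derive_weighted r0)
  (is_derive_invfun (is_derive_expfun m (is_derive_idfun r)) rm).
move=> D; apply: (@is_derive_near _ _ _ _ _ _ (is_derive_eq D _)).
  near=> s; have s0 : 0 < s by near: s; exact: lt_nbhsr.
  by rewrite mulrAC divff ?mul1r// expf_neq0// gt_eqF.
rewrite kappa_sqr mulr1 /=.
have mE : r ^+ m = r ^+ m.-1 * r by rewrite -exprSr prednK.
rewrite [r ^+ m.+1]exprS mE -[m.+2%:R]/((2 + m)%:R) natrD.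
move: rm; rewrite mE mulf_eq0 negb_or => /andP[r1 r2].
by field; rewrite r1 r2 -natrD pnatr_eq0.
Unshelve. all: by end_near. Qed.

(** Otherwise [r ^+ m * G r], which is nondecreasing, would vanish on an
    interval, where its derivative is positive because [h > 1]. *)
Lemma G_gt0 r : 0 < r -> 0 < G r.
Proof.
move=> r0; rewrite lt_neqAle G_ge0 andbT eq_sym; apply/eqP => Gr.
pose D s := m.+2%:R * s ^+ m.+1 * root_curv h s (G s) ^+ 2.
have D0 s : 0 <= s -> 0 <= D s.
  by move=> s0; rewrite /D !mulr_ge0 ?exprn_ge0 ?root_curv_ge0.
have cP : continuous (fun s => s ^+ m * G s).
  by move=> s; apply: cvgM; [exact: exprn_continuous|exact: continuous_G].
have P_mono s t : 0 <= s -> s <= t -> s ^+ m * G s <= t ^+ m * G t.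
  move=> s0 st; apply: (@le_of_derive _ (fun s => s ^+ m * G s) D) => //.
  - exact: continuous_subspaceT.
  - by move=> x /andP[sx _]; apply: is_derive_weighted; lra.
  - by move=> x /andP[sx _]; apply: D0; lra.
have Gs s : 0 < s -> s <= r -> G s = 0.
  move=> s0 sr; have := P_mono _ _ (ltW s0) sr; rewrite Gr mulr0.
  rewrite pmulr_rle0 ?exprn_gt0// => Gs0.
  by apply/le_anti; rewrite Gs0 G_ge0.
have r2 : r / 2 < r by lra.
suff : (r / 2) ^+ m * G (r / 2) < r ^+ m * G r.
  by rewrite Gr Gs ?mulr0 ?ltxx; [|lra|exact: ltW].
apply: (@lt_of_derive _ (fun s => s ^+ m * G s) D) => //.
- exact: continuous_subspaceT.
- by move=> x /andP[sx _]; apply: is_derive_weighted; lra.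
- move=> x /andP[sx xr]; have x0 : 0 < x by lra.
  have s0 : 0 < root_curv h x 0.
    by rewrite /root_curv normr0 addr0 sqrtr1 lt_max subr_gt0 h_gt1 orbT.
  by rewrite /D Gs ?(ltW xr)// (mulr_gt0 (mulr_gt0 _ _)) ?exprn_gt0 ?ltr0n.
Qed.

(** Near the origin the profile is that of the hyperboloid with all curvatures
    equal to [h 0 - 1]. *)
Lemma G_near0 : G r / r ^+ 2 @[r --> 0^'+] --> (h 0 - 1) ^+ 2.
Proof.
set L := (h 0 - 1) ^+ 2.
apply/cvgrPdist_le => e e0.
have cS : {for 0, continuous (fun s => root_curv h s (G s) ^+ 2)}.
  apply: (@continuous_comp _ _ _ (fun s => root_curv h s (G s)) (fun t => t ^+ 2)).
    by apply: continuous_root_curv => //; exact: continuous_G.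
  exact: exprn_continuous.
have S0 : root_curv h 0 (G 0) ^+ 2 = L.
  rewrite /root_curv G_at0 normr0 addr0 sqrtr1 maxElt subr_gt0 h_gt1//.
have /cvgrPdist_le/(_ _ e0)[d /= d0 Hd] := cS.
exists d => //= r; rewrite /ball_/= sub0r normrN => rd r0.
rewrite gtr0_norm// in rd.
rewrite distrC -(ler_pM2r (exprn_gt0 m.+2 r0)).
rewrite -[X in `|_| * X](ger0_norm (exprn_ge0 m.+2 (ltW r0))) -normrM mulrBl.
have -> : G r / r ^+ 2 * r ^+ m.+2 = r ^+ m * G r.
  by rewrite -[m.+2]add2n exprD mulrA divfK ?expf_neq0 ?gt_eqF// mulrC.
apply: (@norm_le_of_derive _ (fun s => s ^+ m * G s - L * s ^+ m.+2)
  (fun s => e * s ^+ m.+2)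
  (fun s => m.+2%:R * s ^+ m.+1 * root_curv h s (G s) ^+ 2 -
            L * (m.+2%:R * s ^+ m.+1))
  (fun s => e * (m.+2%:R * s ^+ m.+1))) => //.
- exact: ltW.
- move=> x _; apply: cvgB; last exact: continuous_power.
  by apply: cvgM; [exact: exprn_continuous|exact: continuous_G].
- by move=> x _; exact: continuous_power.
- move=> x /andP[x0 _]; apply: is_derive_subfun; last exact: is_derive_power.
  exact: is_derive_weighted.
- by move=> x _; exact: is_derive_power.
- move=> x /andP[x0 xr].
  have -> : m.+2%:R * x ^+ m.+1 * root_curv h x (G x) ^+ 2 -
    L * (m.+2%:R * x ^+ m.+1) =
    (root_curv h x (G x) ^+ 2 - L) * (m.+2%:R * x ^+ m.+1) by ring.
  have w0 : 0 <= m.+2%:R * x ^+ m.+1 by rewrite mulr_ge0// exprn_ge0// ltW.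
  rewrite normrM [X in _ * X]ger0_norm// ler_wpM2r// distrC -S0.
  by apply: Hd; rewrite /ball_/= sub0r normrN gtr0_norm// (lt_trans xr).
- by rewrite G_at0 !expr0n !mulr0 subrr.
- by rewrite expr0n mulr0.
Qed.

Lemma tilt_near0 : Num.sqrt (G r) / r @[r --> 0^'+] --> h 0 - 1.
Proof.
have -> : h 0 - 1 = Num.sqrt ((h 0 - 1) ^+ 2).
  by rewrite sqrtr_sqr gtr0_norm// subr_gt0.
apply: cvg_trans (continuous_cvg _ (@sqrt_continuous R _) G_near0).
apply: near_eq_cvg; near=> r; have r0 : 0 < r by near: r; exact: nbhs_right_gt.
by rewrite /= sqrtrM ?G_ge0// sqrtrV ?sqr_ge0// sqrtr_sqr gtr0_norm.
Unshelve. all: by end_near. Qed.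

(** [1 / sqrt (1 - f'^2)], in terms of the squared tilt. *)
Definition lapse r := Num.sqrt (1 + G r).

Lemma lapse_gt0 r : 0 < lapse r.
Proof. by rewrite sqrtr_gt0 ltr_wpDr ?G_ge0. Qed.

Lemma lapse_sqr r : lapse r ^+ 2 = 1 + G r.
Proof. by rewrite sqr_sqrtr// addr_ge0// G_ge0. Qed.

Lemma continuous_lapse : continuous lapse.
Proof.
move=> r; apply: continuous_comp; last exact: sqrt_continuous.
by apply: cvgD; [exact: cvg_cst|exact: continuous_G].
Qed.

(** Positivity of [margin] is stronger than that of [h - lapse]; it is exactly
    the statement that the tilt increases. *)
Definition margin r := h r - lapse r - kappa * (Num.sqrt (G r) / r).

Lemma continuous_margin r : 0 < r -> {for r, continuous margin}.
Proof.
move=> r0; apply: cvgB.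
  by apply: cvgB; [exact: h_cont|exact: continuous_lapse].
apply: cvgMr; apply: cvgM.
  by apply: continuous_comp; [exact: continuous_G|exact: sqrt_continuous].
by apply: cvgV; [rewrite gt_eqF|exact: cvg_id].
Qed.

(** At a first zero of [margin] the tilt would be stationary, so the barrier
    [lapse + kappa * tilt / r] would strictly decrease there; but it would reach
    the nondecreasing [h] from below. *)
Lemma margin_gt0 r : 0 < r -> 0 < margin r.
Proof.
apply: gt0_of_no_first_zero; first exact: continuous_margin.
  have c : margin r @[r --> 0^'+] --> h 0 - 1 - kappa * (h 0 - 1).
    apply: cvgB; last by apply: cvgMr; exact: tilt_near0.
    apply: cvgB; first by apply: cvg_at_right_filter; exact: h_cont.
    have -> : 1 = lapse 0 by rewrite /lapse G_at0 addr0 sqrtr1.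
    by apply: cvg_at_right_filter; exact: continuous_lapse.
  have h0 := h_gt1 0; have k1 := kappa_lt1.
  apply: (cvgr_gt _ c); rewrite (_ : _ - _ = (h 0 - 1) * (1 - kappa)); last ring.
  by rewrite mulr_gt0// subr_gt0.
move=> {}r r0 Er before; have Gr := G_gt0 r0; have k0 := kappa_gt0.
have sG : 0 < Num.sqrt (G r) by rewrite sqrtr_gt0.
have vE : h r - Num.sqrt (1 + `|G r|) = kappa * (Num.sqrt (G r) / r).
  by move: Er; rewrite /margin /lapse ger0_norm ?G_ge0//; lra.
have v0 : 0 < kappa * (Num.sqrt (G r) / r) by rewrite mulr_gt0// divr_gt0.
have DG : is_derive r 1 G 0.
  apply: is_derive_eq (is_derive_G r0) _.
  rewrite /root_curv vE maxElt v0 exprMn expr_div_n.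
  rewrite [Num.sqrt (G r) ^+ 2]sqr_sqrtr ?(ltW Gr)//.
  by rewrite subrr mulr0.
have G1 : 0 < 1 + G r by rewrite ltr_wpDr ?G_ge0.
have D := is_derive_addfun
  (is_derive_sqrtfun (is_derive_addfun (is_derive_cstfun 1 r 1) DG) G1)
  (is_derive_mulfun (is_derive_cstfun kappa r 1)
    (is_derive_mulfun (is_derive_sqrtfun DG Gr)
      (is_derive_invfun (is_derive_idfun r) (lt0r_neq0 r0)))).
suff : 0 <= - (kappa * (Num.sqrt (G r) / r ^+ 2)).
  by rewrite oppr_ge0 leNgt mulr_gt0// divr_gt0// exprn_gt0.
apply: (@derive_ge0_left _ _ 0 r _ (is_derive_eq D _)) => //.
  by field; rewrite !gt_eqF// sqrtr_gt0.
move=> s s0r; have /andP[s0 sr] := s0r.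
have := before _ s0r; have := h_mono (ltW s0) (ltW sr).
by move: Er; rewrite /margin /lapse; lra.
Unshelve. all: by end_near. Qed.

Lemma lapse_lt_h r : 0 <= r -> lapse r < h r.
Proof.
rewrite le_eqVlt => /orP[/eqP<-|r0].
  by rewrite /lapse G_at0 addr0 sqrtr1.
have := margin_gt0 r0; rewrite /margin => E0.
have : 0 < kappa * (Num.sqrt (G r) / r).
  by rewrite mulr_gt0 ?kappa_gt0// divr_gt0// sqrtr_gt0 G_gt0.
lra.
Qed.

Lemma root_curvE r : 0 <= r -> root_curv h r (G r) = h r - lapse r.
Proof.
move=> r0; rewrite /root_curv ger0_norm ?G_ge0// -/(lapse r).
by rewrite maxElt subr_gt0 lapse_lt_h.
Qed.

(** The derivative of [G], obtained from that of [r ^+ m * G r]. *)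
Definition dG r :=
  m.+2%:R * r * ((h r - lapse r) ^+ 2 - kappa ^+ 2 * (G r / r ^+ 2)).

Lemma is_derive_dG r : 0 < r -> is_derive r 1 G (dG r).
Proof. by move=> r0; rewrite /dG -root_curvE ?(ltW r0)//; exact: is_derive_G. Qed.

(** Since the tilt is bounded, this is what makes [margin] integrable. *)
Lemma margin_le_dG r : 0 < r ->
  m.+2%:R * kappa * Num.sqrt (G r) * margin r <= dG r.
Proof.
move=> r0; have E0 := margin_gt0 r0.
have k0 : 0 < kappa * (Num.sqrt (G r) / r).
  by rewrite mulr_gt0 ?kappa_gt0// divr_gt0// sqrtr_gt0 G_gt0.
have -> : dG r = m.+2%:R * r * margin r *
    (margin r + 2 * (kappa * (Num.sqrt (G r) / r))).
  rewrite /dG -{1}[G r]sqr_sqrtr ?G_ge0// /margin; field.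
  by rewrite gt_eqF.
have -> : m.+2%:R * kappa * Num.sqrt (G r) * margin r =
    m.+2%:R * r * margin r * (kappa * (Num.sqrt (G r) / r)).
  by field; rewrite gt_eqF.
by rewrite ler_wpM2l ?mulr_ge0 ?(ltW r0) ?(ltW E0)//; lra.
Qed.

Lemma dG_gt0 r : 0 < r -> 0 < dG r.
Proof.
move=> r0; apply: lt_le_trans (margin_le_dG r0).
by rewrite !mulr_gt0 ?kappa_gt0 ?margin_gt0 ?sqrtr_gt0 ?G_gt0 ?ltr0n.
Qed.

Lemma G_incr r s : 0 <= r -> r < s -> G r < G s.
Proof.
move=> r0 rs; apply: (@lt_of_derive _ G dG) => //.
- exact/continuous_subspaceT/continuous_G.
- by move=> x /andP[rx _]; apply: is_derive_dG; lra.
- by move=> x /andP[rx _]; apply: dG_gt0; lra.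
Qed.

Lemma lapse_ltC r : 0 <= r -> lapse r < C.
Proof. by move=> r0; apply: lt_le_trans (lapse_lt_h r0) (h_le r). Qed.

Lemma lapse_ge1 r : 1 <= lapse r.
Proof. by rewrite -[leLHS]sqrtr1 ler_wsqrtr// lerDl G_ge0. Qed.

Lemma G_ltC2 r : 0 <= r -> G r < C ^+ 2.
Proof.
move=> r0; have : lapse r ^+ 2 < C ^+ 2.
  have l0 := ltW (lapse_gt0 r); have lC := lapse_ltC r0.
  by rewrite ltr_pXn2r ?nnegrE// (le_trans l0)// ltW.
by rewrite lapse_sqr; lra.
Qed.

(** If [lapse] stayed below some [c < C], then [h - lapse] would stay bounded
    below and [G], having then a derivative bounded below, would be
    unbounded. *)
Lemma lapse_lim : h r @[r --> +oo] --> C -> lapse r @[r --> +oo] --> C.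
Proof.
move=> h_lim.
have lapse_mono r s : 0 <= r -> r <= s -> lapse r <= lapse s.
  move=> r0; rewrite le_eqVlt => /orP[/eqP->//|rs].
  by rewrite ler_wsqrtr// lerD2l ltW// G_incr.
suff H c : c < C -> exists2 r, 0 < r & c <= lapse r.
  apply/cvgrPdist_le => e e0.
  have Ce : C - e < C by lra.
  have [r r0 cr] := H _ Ce.
  near=> s.
  have rs : r <= s by near: s; apply: nbhs_pinfty_ge; exact: num_real.
  have rsE := lapse_mono _ _ (ltW r0) rs.
  have s0 : 0 <= s by lra.
  by have sC := lapse_ltC s0; rewrite ger0_norm; lra.
move=> cC; apply: contrapT => noR.
have low r : 0 < r -> lapse r < c.
  by move=> r0; rewrite ltNge; apply/negP => cr; apply: noR; exists r.
pose d := (C - c) / 2.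
have d0 : 0 < d by rewrite /d; lra.
have k0 := kappa_gt0; have k1 := kappa_lt1.
have far : \forall r \near +oo,
    [/\ 1 <= r, d <= h r - c & C ^+ 2 / r ^+ 2 <= d ^+ 2 / 2].
  have /cvgrPdist_le/(_ _ d0) hd := h_lim.
  near=> r; have r1 : 1 <= r by near: r; apply: nbhs_pinfty_ge; exact: num_real.
  split=> //.
    have : `|C - h r| <= d by near: r; exact: hd.
    by rewrite ler_norml /d; lra.
  have : 2 * C ^+ 2 / d ^+ 2 <= r by near: r; apply: nbhs_pinfty_ge; exact: num_real.
  rewrite !ler_pdivrMr ?exprn_gt0 ?(lt_le_trans _ r1)// => le.
  have : 0 <= d ^+ 2 * r * (r - 1).
    apply: mulr_ge0; last by rewrite subr_ge0.
    by apply: mulr_ge0; [exact: sqr_ge0|exact: le_trans r1].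
  lra.
have [M [_ HM]] := far.
pose r1 := Num.max M 1 + 1; pose s := r1 + C ^+ 2 / d ^+ 2 + 1.
have Mr1 : M < r1 by rewrite (@le_lt_trans _ _ (Num.max M 1)) ?ltrDl// le_max lexx.
have r1_gt0 : 0 < r1.
  by rewrite (@lt_trans _ _ (Num.max M 1)) ?ltrDl// lt_max ltr01 orbT.
have q0 : 0 <= C ^+ 2 / d ^+ 2 by rewrite divr_ge0 ?sqr_ge0.
have s_gt0 : 0 < s by rewrite /s; lra.
have : G r1 - d ^+ 2 * r1 ^+ 1 <= G s - d ^+ 2 * s ^+ 1.
  apply: (@le_of_derive _ (fun t => G t - d ^+ 2 * t ^+ 1)
    (fun t => dG t - d ^+ 2 * (1 * t ^+ 0))).
  - by rewrite /s; lra.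
  - apply: continuous_subspaceT => t.
    by apply: cvgB; [exact: continuous_G|exact: continuous_power].
  - move=> t /andP[tr _]; apply: is_derive_subfun; last exact: is_derive_power.
    by apply: is_derive_dG; lra.
  - move=> t /andP[tr _]; have [t1 ht Ct] := HM t (lt_trans Mr1 tr).
    have t0 : 0 < t by lra.
    have kG : kappa ^+ 2 * (G t / t ^+ 2) <= d ^+ 2 / 2.
      apply: le_trans Ct; rewrite -[leRHS]mul1r ler_pM ?sqr_ge0//.
      + by rewrite divr_ge0 ?sqr_ge0 ?G_ge0.
      + by rewrite expr_le1 ?ltW.
      + by rewrite ler_wpM2r ?invr_ge0 ?sqr_ge0// ltW// G_ltC2// ltW.
    have dv : d ^+ 2 <= (h t - lapse t) ^+ 2.
      have lt := low _ t0; apply: lerXn2r; rewrite ?nnegrE; lra.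
    have n2 : 2 <= m.+2%:R * t.
      have : 2%:R <= m.+2%:R :> R by rewrite ler_nat.
      by move=> n2; apply: le_trans n2 _; rewrite ler_peMr.
    have : 2 * (d ^+ 2 / 2) <= dG t.
      by rewrite /dG ler_pM// ?divr_ge0 ?sqr_ge0//; lra.
    by rewrite expr0 !mulr1 subr_ge0; lra.
have := G_ge0 r1; have := G_ltC2 (ltW s_gt0).
have -> : d ^+ 2 * s ^+ 1 = d ^+ 2 * r1 ^+ 1 + C ^+ 2 + d ^+ 2.
  by rewrite /s !expr1; field; rewrite gt_eqF.
have : 0 < d ^+ 2 by rewrite exprn_gt0.
lra.
Unshelve. all: by end_near. Qed.

Lemma lapse_at0 : lapse 0 = 1.
Proof. by rewrite /lapse G_at0 addr0 sqrtr1. Qed.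

Definition slope r := Num.sqrt (G r) / lapse r.
Definition dslope r := dG r / (2 * Num.sqrt (G r) * lapse r ^+ 3).

Lemma slope_ge0 r : 0 <= slope r.
Proof. by rewrite divr_ge0 ?sqrtr_ge0// ltW// lapse_gt0. Qed.

Lemma slope_sqr r : 1 - slope r ^+ 2 = (lapse r ^+ 2)^-1.
Proof.
rewrite /slope expr_div_n sqr_sqrtr ?G_ge0// -[1](@divff _ (lapse r ^+ 2)).
  by rewrite -mulrBl lapse_sqr [1 + _]addrC addrAC subrr add0r mul1r.
by rewrite expf_neq0// gt_eqF// lapse_gt0.
Qed.

Lemma is_derive_slope r : 0 < r -> is_derive r 1 slope (dslope r).
Proof.
move=> r0; have D := is_derive_dG r0.
have Gr := G_gt0 r0; have l0 := lapse_gt0 r.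
have G1 : 0 < 1 + G r by rewrite ltr_wpDr ?G_ge0.
have := is_derive_mulfun (is_derive_sqrtfun D Gr) (is_derive_invfun
  (is_derive_sqrtfun (is_derive_addfun (is_derive_cstfun 1 r 1) D) G1)
  (lt0r_neq0 l0)).
move/is_derive_eq; apply; rewrite -/(lapse r) /dslope add0r.
have q0 : 0 < Num.sqrt (G r) by rewrite sqrtr_gt0.
have E : lapse r ^+ 2 = 1 + Num.sqrt (G r) ^+ 2.
  by rewrite lapse_sqr sqr_sqrtr ?G_ge0.
have -> : dG r / (2 * Num.sqrt (G r) * lapse r ^+ 3) =
    (lapse r ^+ 2 - Num.sqrt (G r) ^+ 2) * dG r /
      (2 * Num.sqrt (G r) * lapse r ^+ 3) by rewrite E addrK mul1r.
by field; rewrite !gt_eqF// lapse_gt0.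
Qed.

Lemma continuous_slope : continuous slope.
Proof.
move=> r; apply: cvgM.
  by apply: continuous_comp; [exact: continuous_G|exact: sqrt_continuous].
by apply: cvgV; [rewrite gt_eqF// lapse_gt0|exact: continuous_lapse].
Qed.

Lemma continuous_dG r : 0 < r -> {for r, continuous (dG)}.
Proof.
move=> r0; apply: cvgM; first by apply: cvgMr; exact: cvg_id.
apply: cvgB.
  apply: (@continuous_comp _ _ _ (fun s => h s - lapse s) (fun t => t ^+ 2)).
    by apply: cvgB; [exact: h_cont|exact: continuous_lapse].
  exact: exprn_continuous.
apply: cvgMr; apply: cvgM; first exact: continuous_G.
by apply: cvgV; [rewrite expf_neq0 ?gt_eqF|exact: exprn_continuous].
Qed.

Lemma continuous_dslope r : 0 < r -> {for r, continuous dslope}.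
Proof.
move=> r0.
have cd : {for r, continuous (fun s => 2 * Num.sqrt (G s) * lapse s ^+ 3)}.
  apply: continuous_mulfun.
    apply: continuous_mulfun; first exact: cst_continuous.
    by apply: continuous_comp; [exact: continuous_G|exact: sqrt_continuous].
  apply: (@continuous_comp _ _ _ lapse (fun t => t ^+ 3)).
    exact: continuous_lapse.
  exact: exprn_continuous.
apply: cvgM; first exact: continuous_dG.
apply: cvgV; last exact: cd.
by rewrite gt_eqF// !mulr_gt0 ?exprn_gt0 ?lapse_gt0 ?sqrtr_gt0 ?G_gt0.
Qed.

Lemma slope_near0 : slope r / r @[r --> 0^'+] --> h 0 - 1.
Proof.
have -> : h 0 - 1 = (h 0 - 1) / lapse 0 by rewrite lapse_at0 divr1.
have -> : (fun r => slope r / r) = (fun r => Num.sqrt (G r) / r / lapse r).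
  by apply/funext => r; rewrite /slope mulrAC.
apply: cvgM; first exact: tilt_near0.
apply: cvgV; first by rewrite gt_eqF// lapse_gt0.
by apply: cvg_at_right_filter; exact: continuous_lapse.
Qed.

Lemma dslope_near0 : dslope r @[r --> 0^'+] --> h 0 - 1.
Proof.
have h0 : 0 < h 0 - 1 by rewrite subr_gt0.
pose k r := m.+2%:R * ((h r - lapse r) ^+ 2 - kappa ^+ 2 * (G r / r ^+ 2)) /
  (2 * (Num.sqrt (G r) / r) * lapse r ^+ 3).
have kE : k r @[r --> 0^'+] --> m.+2%:R *
    ((h 0 - lapse 0) ^+ 2 - kappa ^+ 2 * (h 0 - 1) ^+ 2) /
    (2 * (h 0 - 1) * lapse 0 ^+ 3).
  have c3 : {for 0, continuous (fun r => lapse r ^+ 3)}.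
    apply: (@continuous_comp _ _ _ (lapse) (fun t => t ^+ 3)).
      exact: continuous_lapse.
    exact: exprn_continuous.
  have c2 : {for 0, continuous (fun r => (h r - lapse r) ^+ 2)}.
    apply: (@continuous_comp _ _ _ (fun r => h r - lapse r) (fun t => t ^+ 2)).
      by apply: cvgB; [exact: h_cont|exact: continuous_lapse].
    exact: exprn_continuous.
  apply: cvgM.
    apply: cvgMr; apply: cvgB; first exact: cvg_at_right_filter.
    by apply: cvgMr; exact: G_near0.
  apply: cvgV; first by rewrite lapse_at0 expr1n mulr1 mulf_neq0// gt_eqF.
  apply: cvgM; last exact: cvg_at_right_filter.
  by apply: cvgMr; exact: tilt_near0.
have -> : h 0 - 1 = m.+2%:R *
    ((h 0 - lapse 0) ^+ 2 - kappa ^+ 2 * (h 0 - 1) ^+ 2) /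
    (2 * (h 0 - 1) * lapse 0 ^+ 3).
  rewrite lapse_at0 kappa_sqr -[m.+2]add2n natrD; field.
  by rewrite (gt_eqF h0) -natrD pnatr_eq0.
apply: cvg_trans kE; apply: near_eq_cvg; near=> r.
have r0 : 0 < r by near: r; exact: nbhs_right_gt.
rewrite /k /dslope /dG; field.
by rewrite !gt_eqF ?lapse_gt0 ?sqrtr_gt0 ?G_gt0.
Unshelve. all: by end_near. Qed.

(** [M s = f'(r) / r] at [r = sqrt s], extended by its limit for [s <= 0]. *)
Definition slope_ratio s :=
  if 0 < s then slope (Num.sqrt s) / Num.sqrt s else h 0 - 1.

Definition dslope_ratio s := (dslope (Num.sqrt s) - slope_ratio s) / s.

Lemma slope_ratioE r : 0 < r -> slope_ratio (r ^+ 2) = slope r / r.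
Proof.
by move=> r0; rewrite /slope_ratio exprn_gt0// sqrtr_sqr gtr0_norm.
Qed.

Lemma slope_ratio_slope r : 0 <= r -> r * slope_ratio (r ^+ 2) = slope r.
Proof.
rewrite le_eqVlt => /orP[/eqP<-|r0].
  by rewrite mul0r /slope G_at0 sqrtr0 mul0r.
by rewrite slope_ratioE// mulrC divfK// gt_eqF.
Qed.

Lemma cvg_sqrt_near0 : Num.sqrt s @[s --> (0 : R)^'+] --> (0 : R)^'+.
Proof.
move=> A [e /= e0 He]; exists (e ^+ 2) => /=; first by rewrite exprn_gt0.
move=> s; rewrite /ball_/= sub0r normrN => se s0; rewrite gtr0_norm// in se.
apply: He; last by rewrite sqrtr_gt0.
rewrite /ball_/= sub0r normrN ger0_norm ?sqrtr_ge0//.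
by rewrite -[ltRHS](gtr0_norm e0) -sqrtr_sqr ltr_sqrt// exprn_gt0.
Qed.

Lemma slope_ratio_near0 : slope_ratio s @[s --> 0^'+] --> h 0 - 1.
Proof.
apply: cvg_trans (cvg_comp _ _ cvg_sqrt_near0 slope_near0).
apply: near_eq_cvg; near=> s; have s0 : 0 < s by near: s; exact: nbhs_right_gt.
by rewrite /slope_ratio s0.
Unshelve. all: by end_near. Qed.

Lemma is_derive_slope_ratio s : 0 < s ->
  is_derive s 1 slope_ratio (dslope_ratio s / 2).
Proof.
move=> s0; have r0 : 0 < Num.sqrt s by rewrite sqrtr_gt0.
rewrite /dslope_ratio {2}/slope_ratio s0.
apply: is_derive_near (is_derive_ratio_sqrt s0 (is_derive_slope r0)).
by near=> t; rewrite /slope_ratio ifT//; near: t; exact: lt_nbhsr.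
Unshelve. all: by end_near. Qed.

Lemma continuous_slope_ratio : continuous slope_ratio.
Proof.
move=> s; case: (ltgtP s 0) => [s0|s0|->].
- apply: cvg_near_cst; near=> t; rewrite /slope_ratio.
  have t0 : t < 0 by near: t; exact: lt_nbhsl.
  by rewrite !ltNge (ltW t0) (ltW s0).
- exact: is_derive_continuous (is_derive_slope_ratio s0).
- apply/cvgrPdist_lt => e e0.
  have /cvgrPdist_lt/(_ _ e0)[d /= d0 Hd] := slope_ratio_near0.
  have M0 : slope_ratio 0 = h 0 - 1 by rewrite /slope_ratio ltxx.
  exists d => //= t td; rewrite M0; have [t0|t0] := ltP 0 t; first exact: Hd.
  by rewrite /slope_ratio [0 < t]ltNge t0 subrr normr0.
Unshelve. all: by end_near. Qed.

Lemma continuous_dslope_ratio s : 0 < s -> {for s, continuous dslope_ratio}.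
Proof.
move=> s0.
have cd : {for s, continuous (fun t => dslope (Num.sqrt t))}.
  apply: continuous_comp; first exact: sqrt_continuous.
  by apply: continuous_dslope; rewrite sqrtr_gt0.
have cb : {for s, continuous (fun t => dslope (Num.sqrt t) - slope_ratio t)}.
  by apply: cvgB; [exact: cd|exact: continuous_slope_ratio].
by apply: cvgM; [exact: cb|apply: cvgV; [rewrite gt_eqF|exact: cvg_id]].
Qed.

Lemma dslope_ratio_near0 : s * dslope_ratio s @[s --> 0^'+] --> 0.
Proof.
have c : dslope (Num.sqrt s) - slope_ratio s @[s --> 0^'+] -->
    (h 0 - 1) - (h 0 - 1).
  apply: cvgB; last exact: slope_ratio_near0.
  exact: cvg_comp cvg_sqrt_near0 dslope_near0.
rewrite subrr in c; apply: cvg_trans c; apply: near_eq_cvg.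
near=> s; have s0 : 0 < s by near: s; exact: nbhs_right_gt.
by rewrite /= /dslope_ratio mulrC divfK// gt_eqF.
Unshelve. all: by end_near. Qed.

Lemma slope_incr r s : 0 <= r -> r < s -> slope r < slope s.
Proof.
move=> r0 rs; apply: (@lt_of_derive _ slope dslope) => //.
- exact/continuous_subspaceT/continuous_slope.
- by move=> x /andP[rx _]; apply: is_derive_slope; lra.
- move=> x /andP[rx _]; have x0 : 0 < x by lra.
  by rewrite divr_gt0 ?dG_gt0// !mulr_gt0 ?exprn_gt0 ?lapse_gt0 ?sqrtr_gt0 ?G_gt0.
Qed.

Lemma slopeE r : slope r = Num.sqrt (1 - (lapse r ^+ 2)^-1).
Proof.
by rewrite -slope_sqr opprB addrCA subrr addr0 sqrtr_sqr ger0_norm ?slope_ge0.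
Qed.

Lemma slope_lim : h r @[r --> +oo] --> C ->
  slope r @[r --> +oo] --> Num.sqrt (1 - (C ^+ 2)^-1).
Proof.
move=> h_lim.
have C0 : 0 < C by apply: lt_le_trans (h_le 0); apply: lt_trans (h_gt1 0).
have -> : slope = (fun r => Num.sqrt (1 - (lapse r ^+ 2)^-1)).
  by apply/funext => r; exact: slopeE.
apply: (continuous_cvg _ (@sqrt_continuous R _)).
apply: cvgB; first exact: cvg_cst.
apply: cvgV; first by rewrite expf_neq0// gt_eqF.
apply: (continuous_cvg _ (@exprn_continuous R 2 _)).
exact: lapse_lim.
Qed.

(** First order expansion of the slope at the limit cone, with an explicit
    quadratic remainder: [g / q] is the slope when the tilt is [g] and the
    lapse [q]. *)
Lemma slope_expansion (c q g : R) : 1 <= q -> q <= C -> 0 <= g -> g <= c ->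
  0 < c -> C ^+ 2 = 1 + c ^+ 2 -> q ^+ 2 = 1 + g ^+ 2 ->
  `|c / C - g / q - (C - q) / (c * C ^+ 2)| <=
    2 * (4 * C ^+ 2 / c ^+ 2 + 1) / c * (C - q) ^+ 2 /\
  c - g <= 2 * C / c * (C - q).
Proof.
move=> q1 qC g0 gc c0 Cc qg.
have C0 : 0 < C by lra.
have q0 : 0 < q by lra.
(* (c, C) and (g, q) lie on the same hyperbola. *)
have yz : (c - g) * (c + g) = (C - q) * (C + q).
  by rewrite -!subr_sqr Cc qg; ring.
have y_le : c - g <= 2 * C / c * (C - q).
  rewrite [leRHS]mulrAC ler_pdivlMr//.
  have : (c - g) * c <= (c - g) * (c + g) by rewrite ler_wpM2l; lra.
  rewrite yz; move/le_trans; apply.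
  have : (C - q) * (C + q) <= (C - q) * (2 * C) by rewrite ler_wpM2l; lra.
  lra.
split=> //.
have -> : c / C - g / q - (C - q) / (c * C ^+ 2) =
    (C ^+ 2 * ((c - g) ^+ 2 - (C - q) ^+ 2) / 2 + (C - q) ^+ 2) /
      (c * C ^+ 2 * q).
  apply: (mulIf (x := c * C ^+ 2 * q)).
    by rewrite !mulf_neq0 ?expf_neq0// gt_eqF.
  rewrite divfK; last by rewrite !mulf_neq0 ?expf_neq0// gt_eqF.
  have -> : (c / C - g / q - (C - q) / (c * C ^+ 2)) * (c * C ^+ 2 * q) =
      c ^+ 2 * C * q - c * C ^+ 2 * g - (C - q) * q.
    by field; rewrite !gt_eqF.
  have c2 : c ^+ 2 = C ^+ 2 - 1 by rewrite Cc; ring.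
  have g2 : g ^+ 2 = q ^+ 2 - 1 by rewrite qg; ring.
  have -> : (c - g) ^+ 2 = C ^+ 2 + q ^+ 2 - 2 - 2 * (c * g).
    by rewrite sqrrB c2 g2; ring.
  by rewrite c2; field.
set y := c - g in y_le *; set z := C - q in y_le *.
have z0 : 0 <= z by rewrite subr_ge0.
have y0 : 0 <= y by rewrite subr_ge0.
have y2 : y ^+ 2 <= 4 * C ^+ 2 / c ^+ 2 * z ^+ 2.
  have -> : 4 * C ^+ 2 / c ^+ 2 * z ^+ 2 = (2 * C / c * z) ^+ 2.
    by field; rewrite gt_eqF.
  by rewrite lerXn2r ?nnegrE// (le_trans y0).
have D0 : 0 < c * C ^+ 2 * q by rewrite !mulr_gt0// exprn_gt0.
rewrite normrM normfV [X in _ / X]gtr0_norm// ler_pdivrMr//.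
apply: (@le_trans _ _ (2 * C ^+ 2 * (y ^+ 2 + z ^+ 2))).
  have C2 : 1 <= C ^+ 2 by rewrite Cc lerDl sqr_ge0.
  have a0 : 0 <= (C ^+ 2 - 1) * z ^+ 2 by rewrite mulr_ge0 ?sqr_ge0 ?subr_ge0.
  have a1 : 0 <= C ^+ 2 * y ^+ 2 by rewrite mulr_ge0 ?sqr_ge0.
  have a2 : 0 <= C ^+ 2 * z ^+ 2 by rewrite mulr_ge0 ?sqr_ge0.
  have a3 : 0 <= z ^+ 2 by rewrite sqr_ge0.
  by rewrite ler_norml; apply/andP; split; lra.
have -> : 2 * (4 * C ^+ 2 / c ^+ 2 + 1) / c * z ^+ 2 * (c * C ^+ 2 * q) =
   2 * C ^+ 2 * ((4 * C ^+ 2 / c ^+ 2 * z ^+ 2 + z ^+ 2) * q).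
  by field; rewrite gt_eqF.
apply: ler_wpM2l; first by rewrite mulr_ge0// sqr_ge0.
apply: (@le_trans _ _ (4 * C ^+ 2 / c ^+ 2 * z ^+ 2 + z ^+ 2)).
  by rewrite lerD2r.
by rewrite ler_peMr// addr_ge0 ?sqr_ge0// (le_trans _ y2)// sqr_ge0.
Qed.

Lemma C_gt1 : 1 < C.
Proof. exact: lt_le_trans (h_gt1 0) (h_le 0). Qed.

Lemma cone_slopeE :
  Num.sqrt (1 - (C ^+ 2)^-1) = Num.sqrt (C ^+ 2 - 1) / C.
Proof.
have C1 := C_gt1; have C0 : 0 < C by lra.
have -> : 1 - (C ^+ 2)^-1 = (C ^+ 2 - 1) / C ^+ 2.
  by field; rewrite gt_eqF.
have C2 : 0 <= C ^+ 2 - 1 by rewrite subr_ge0 expr_ge1 ?ltW.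
by rewrite sqrtrM// sqrtrV ?sqr_ge0// sqrtr_sqr gtr0_norm.
Qed.

Lemma margin_le r : 1 <= r ->
  margin r <= (m.+2%:R * kappa * Num.sqrt (G 1))^-1 * dG r.
Proof.
move=> r1; have r0 : 0 < r by lra.
have w : 0 < m.+2%:R * kappa * Num.sqrt (G 1).
  by rewrite !mulr_gt0 ?kappa_gt0 ?sqrtr_gt0 ?G_gt0 ?ltr0n.
rewrite mulrC ler_pdivlMr// mulrC; apply: le_trans (margin_le_dG r0).
rewrite ler_wpM2r ?(ltW (margin_gt0 r0))// ler_wpM2l//.
  by rewrite mulr_ge0// ltW// kappa_gt0.
apply: ler_wsqrtr; move: r1; rewrite le_eqVlt => /orP[/eqP<-//|r1].
exact/ltW/G_incr.
Qed.

(** The slope falls short of its limit by [kappa / (C ^+ 2 * r)], up to terms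
    controlled by the decay of [C - h] and by the integrable [dG]. *)
Lemma slope_defect : exists2 K, 0 < K & forall r, 1 <= r ->
  `|slope r - (Num.sqrt (1 - (C ^+ 2)^-1) - (C ^+ 2)^-1 * kappa / r)| <=
    K * (dG r + (C - h r) + (r ^+ 2)^-1).
Proof.
have C1 := C_gt1; have C0 : 0 < C by lra.
have C2 : 1 < C ^+ 2 by rewrite expr_gt1// ltW.
have k0 := kappa_gt0; have k1 := kappa_lt1.
rewrite cone_slopeE; set c := Num.sqrt (C ^+ 2 - 1).
have c0 : 0 < c by rewrite sqrtr_gt0 subr_gt0.
have cE : C ^+ 2 = 1 + c ^+ 2 by rewrite sqr_sqrtr ?subr_ge0 ?(ltW C2)//; ring.
(* K1 bounds the quadratic remainder, K2 the square of the defect of the tilt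
   by that of the lapse, and K4 the margin by dG. *)
pose K1 := 2 * (4 * C ^+ 2 / c ^+ 2 + 1) / c.
pose K2 := (2 * C / c) ^+ 2.
pose K3 := 3 * (K1 + K2 / c) * C ^+ 2 + c^-1.
pose K4 := (m.+2%:R * kappa * Num.sqrt (G 1))^-1.
have K1_ge0 : 0 <= K1.
  apply: divr_ge0; last exact: ltW.
  apply: mulr_ge0 => //; apply: addr_ge0 => //; apply: divr_ge0; last exact: sqr_ge0.
  by rewrite mulr_ge0 ?sqr_ge0.
have K2_ge0 : 0 <= K2 / c by rewrite divr_ge0 ?sqr_ge0 ?ltW.
have K3_gt0 : 0 < K3.
  rewrite ltr_wpDl ?invr_gt0//; apply: mulr_ge0; last exact: sqr_ge0.
  by rewrite mulr_ge0// addr_ge0.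
have K4_gt0 : 0 < K4.
  by rewrite invr_gt0 !mulr_gt0 ?kappa_gt0 ?sqrtr_gt0 ?G_gt0 ?ltr0n.
exists (K3 * (K4 + 1)); first by rewrite mulr_gt0// addr_gt0.
move=> r r1; have r0 : 0 < r by lra.
have E0 := margin_gt0 r0; have EK := margin_le r1; rewrite -/K4 in EK.
have dG0 := dG_gt0 r0.
set q := lapse r; set g := Num.sqrt (G r); pose t := r^-1.
have t0 : 0 < t by rewrite invr_gt0.
have q1 : 1 <= q := lapse_ge1 r.
have qC : q < C := lapse_ltC (ltW r0).
have g0 : 0 < g by rewrite sqrtr_gt0 G_gt0.
have qg : q ^+ 2 = 1 + g ^+ 2 by rewrite lapse_sqr sqr_sqrtr ?G_ge0.
have q2C2 : q ^+ 2 <= C ^+ 2 by rewrite lerXn2r ?nnegrE//; lra.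
have gc : g <= c.
  by rewrite -[g]ger0_norm ?(ltW g0)// -sqrtr_sqr ler_wsqrtr; lra.
have [X Y] := slope_expansion q1 (ltW qC) (ltW g0) gc c0 cE qg.
rewrite -/K1 in X.
have EE : margin r = h r - q - kappa * (g * t) by [].
move: E0 EK EE; set E := margin r => E0 EK EE.
pose d := C - h r; have d0 : 0 <= d by rewrite subr_ge0.
have zE : C - q = d + E + kappa * (g * t) by rewrite EE /d; ring.
have y0 : 0 <= c - g by rewrite subr_ge0.
have z0 : 0 <= C - q by rewrite subr_ge0 ltW.
have gC : g <= C.
  apply: (le_trans gc); rewrite -[leRHS]gtr0_norm// -sqrtr_sqr ler_wsqrtr; lra.
have z2 : (C - q) ^+ 2 <= 3 * C ^+ 2 * (d + E + t ^+ 2).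
  have kgt : (kappa * (g * t)) ^+ 2 <= C ^+ 2 * t ^+ 2.
    rewrite -exprMn lerXn2r ?nnegrE ?mulr_ge0 ?(ltW k0) ?(ltW g0)
      ?(ltW t0) ?(ltW C0)//.
    rewrite mulrA ler_wpM2r ?(ltW t0)//.
    by apply: le_trans gC; rewrite ler_piMl ?ltW.
  have dC : d ^+ 2 <= C ^+ 2 * d.
    have dlC : d <= C ^+ 2.
      have := h_gt1 r; have : C <= C ^+ 2 by rewrite expr2 ler_peMl// ltW.
      rewrite /d; lra.
    by rewrite expr2 ler_wpM2r.
  have EC : E ^+ 2 <= C ^+ 2 * E.
    have ElC : E <= C ^+ 2.
      have kgt0 : 0 <= kappa * (g * t) by rewrite !mulr_ge0 ?ltW.
      have : C <= C ^+ 2 by rewrite expr2 ler_peMl// ltW.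
      by have := h_le r; lra.
    by rewrite expr2 ler_wpM2r// ltW.
  have sq3 (x1 x2 x3 : R) :
      (x1 + x2 + x3) ^+ 2 <= 3 * (x1 ^+ 2 + x2 ^+ 2 + x3 ^+ 2).
    have := sqr_ge0 (x1 - x2); have := sqr_ge0 (x1 - x3).
    have := sqr_ge0 (x2 - x3); rewrite !expr2; lra.
  by rewrite zE; apply: (le_trans (sq3 _ _ _)); lra.
have y2 : (c - g) ^+ 2 <= K2 * (C - q) ^+ 2.
  by rewrite /K2 -exprMn lerXn2r ?nnegrE// (le_trans y0).
have rest : `|(d + E - kappa * ((c - g) * t)) / (c * C ^+ 2)| <=
    (d + E + t ^+ 2 + (c - g) ^+ 2) / c.
  have yt : (c - g) * t <= t ^+ 2 + (c - g) ^+ 2.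
    have := sqr_ge0 (c - g - t); have := sqr_ge0 (c - g); have := sqr_ge0 t.
    rewrite !expr2; lra.
  have yt0 : 0 <= (c - g) * t := mulr_ge0 y0 (ltW t0).
  have kyt : kappa * ((c - g) * t) <= (c - g) * t by rewrite ler_piMl// ltW.
  have kyt0 : 0 <= kappa * ((c - g) * t) by rewrite mulr_ge0// ltW.
  rewrite normrM normfV [X in _ / X]gtr0_norm ?mulr_gt0 ?exprn_gt0//.
  rewrite invfM mulrCA mulrC ler_wpM2r ?invr_ge0 ?(ltW c0)//.
  apply: (@le_trans _ _ `|d + E - kappa * ((c - g) * t)|).
    by rewrite mulrC ler_piMl// invf_le1 ?exprn_gt0// ltW.
  by rewrite ler_norml; apply/andP; split; lra.
have -> : slope r - (c / C - (C ^+ 2)^-1 * kappa / r) =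
    - ((c / C - g / q - (C - q) / (c * C ^+ 2)) +
       (d + E - kappa * ((c - g) * t)) / (c * C ^+ 2)).
  rewrite zE /slope -/g -/q /t; field.
  by rewrite !gt_eqF// (lt_le_trans _ q1).
rewrite normrN; apply: (le_trans (ler_normD _ _)).
apply: (@le_trans _ _ (K3 * (d + E + t ^+ 2))).
  apply: (le_trans (lerD X rest)).
  apply: (@le_trans _ _ (K1 * (C - q) ^+ 2 +
     ((d + E + t ^+ 2) / c + K2 * (C - q) ^+ 2 / c))).
    by rewrite lerD2l -mulrDl ler_wpM2r ?invr_ge0 ?(ltW c0)// lerD2l.
  have -> : K1 * (C - q) ^+ 2 + ((d + E + t ^+ 2) / c + K2 * (C - q) ^+ 2 / c) =
    (K1 + K2 / c) * (C - q) ^+ 2 + (d + E + t ^+ 2) / c by ring.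
  have -> : K3 * (d + E + t ^+ 2) =
    (K1 + K2 / c) * (3 * C ^+ 2 * (d + E + t ^+ 2)) + (d + E + t ^+ 2) / c.
    by rewrite /K3; ring.
  by rewrite lerD2r ler_wpM2l// addr_ge0.
rewrite -mulrA ler_wpM2l ?(ltW K3_gt0)//.
have -> : (r ^+ 2)^-1 = t ^+ 2 by rewrite /t exprVn.
have t2 : 0 <= t ^+ 2 by exact: sqr_ge0.
rewrite -/d.
have : 0 <= K4 * (d + t ^+ 2) by rewrite mulr_ge0 ?(ltW K4_gt0)// addr_ge0.
lra.
Qed.

(** The remainder in [slope_defect] is dominated by the derivative of a
    function of the form [K * (G r - K' / r)], which is bounded. *)
Lemma profile_asymptotics (f : R -> R) :
  (forall r : R, 0 < r -> is_derive r 1 f (slope r)) ->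
  (exists2 K, 0 < K & \forall r \near +oo, `|1 - h r / C| <= K * `|(r ^+ 2)^-1|) ->
  exists c0 : R, f r - (Num.sqrt (1 - (C ^+ 2)^-1) * r - (C ^+ 2)^-1 * kappa * ln r
    + c0) @[r --> +oo] --> 0.
Proof.
move=> Df [Kh Kh0 [M [_ decay]]].
have C1 := C_gt1; have C0 : 0 < C by lra.
set a := Num.sqrt _; set b := (C ^+ 2)^-1 * kappa.
have [K K0 defect] := slope_defect.
pose r1 := Num.max M 0 + 1.
have r1_ge1 : 1 <= r1 by rewrite lerDr le_max lexx orbT.
have r1M : M < r1 by rewrite (@le_lt_trans _ _ (Num.max M 0)) ?ltrDl// le_max lexx.
pose K' := C * Kh + 1.
have K'0 : 0 <= K' by rewrite addr_ge0// mulr_ge0// ltW.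
pose D r := f r - (a * r ^+ 1 - b * ln r).
pose Phi r := K * (G r - K' * r^-1).
have [l Dl] : exists l : R, D r @[r --> +oo] --> l.
  apply: (@cvg_of_dominated_derive _ D
    (fun r => slope r - (a * (1 * r ^+ 0) - b * r^-1))
    Phi (fun r => K * (dG r + K' * (r ^+ 2)^-1)) r1 (K * (C ^+ 2 + K'))).
  - move=> r rr1; have r0 : 0 < r by lra.
    apply: is_derive_subfun; first exact: Df.
    apply: is_derive_subfun; first exact: is_derive_power.
    have := is_derive_mulfun (is_derive_cstfun b r 1) (is_derive1_ln r0).
    by rewrite mulr0 addr0.
  - move=> r rr1; have r0 : 0 < r by lra.
    have := is_derive_mulfun (is_derive_cstfun K r 1) (is_derive_subfun
      (is_derive_dG r0) (is_derive_mulfun (is_derive_cstfun K' r 1)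
        (is_derive_invfun (is_derive_idfun r) (lt0r_neq0 r0)))).
    by move/is_derive_eq; apply; ring.
  - move=> r rr1; have r0 : 0 < r by lra.
    rewrite expr0 !mulr1 /b; apply: le_trans (defect r _) _; first by lra.
    rewrite ler_wpM2l ?(ltW K0)// -addrA lerD2l mulrDl mul1r lerD2r.
    have := decay r (lt_le_trans r1M rr1).
    rewrite [X in _ <= _ * X]ger0_norm ?invr_ge0 ?sqr_ge0//.
    move=> /(le_trans (ler_norm _)).
    have -> : 1 - h r / C = (C - h r) / C by field; rewrite gt_eqF.
    by rewrite ler_pdivrMr//; lra.
  - move=> r rr1; have r0 : 0 < r by lra.
    rewrite normrM gtr0_norm// ler_wpM2l ?(ltW K0)//.
    apply: (le_trans (ler_normB _ _)); rewrite ger0_norm ?G_ge0//.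
    apply: lerD; first by rewrite ltW// G_ltC2// ltW.
    rewrite ger0_norm ?mulr_ge0 ?invr_ge0 ?(ltW r0)//.
    by rewrite ler_piMr// invf_le1//; lra.
exists l.
have c : D r - l @[r --> +oo] --> l - l by apply: cvgB; [exact: Dl|exact: cvg_cst].
rewrite subrr in c; apply: cvg_trans c; apply: near_eq_cvg; near=> r.
by rewrite /D expr1; ring.
Unshelve. all: by end_near. Qed.

End Profile.

(** * The graph of the profile *)

Section Graph.
Variables (R : realType) (m : nat) (C : R) (h : R -> R) (G : R -> R).
Hypotheses (m_gt0 : (0 < m)%N) (h_cont : continuous h).
Hypothesis h_gt1 : forall r, 1 < h r.
Hypothesis h_mono : forall r s, 0 <= r -> r <= s -> h r <= h s.
Hypothesis G_fix : picard_image m C h G G.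
Local Notation n := m.+2.
Local Notation M := (slope_ratio h G).
Local Notation N := (dslope_ratio m h G).

Implicit Types x : 'rV[R]_n.

Variable U : R -> R.
Hypothesis DU : forall s : R, -1 < s -> is_derive s 1 U (M s / 2).

Let u (x : 'rV[R]_n) := U (sqnorm x).

Let DU0 (s : R) : 0 <= s -> is_derive s 1 U (M s / 2).
Proof. by move=> s0; apply: DU; lra. Qed.

Let DM (s : R) : 0 < s -> is_derive s 1 M (N s / 2).
Proof. exact: (is_derive_slope_ratio m_gt0 h_cont h_gt1 h_mono G_fix). Qed.

Let M_cont : continuous M.
Proof. exact: (continuous_slope_ratio m_gt0 h_cont h_gt1 h_mono G_fix). Qed.

Let pderivE i x : pderiv i u x = M (sqnorm x) * x 0 i.
Proof. by rewrite (pderiv_u DU0). Qed.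

Let pderiv2E i j x : pderiv j (pderiv i u) x =
  M (sqnorm x) * (i == j)%:R + N (sqnorm x) * x 0 i * x 0 j.
Proof. by rewrite (pderiv2_u DU0 M_cont DM). Qed.

Lemma graph_classC2 : classC 2 u.
Proof.
apply: (@classC2_radial _ _ U M N DU0 M_cont DM).
  exact: (continuous_dslope_ratio m_gt0 h_cont h_gt1 h_mono G_fix).
exact: (dslope_ratio_near0 h_cont h_gt1 G_fix).
Qed.

Lemma enorm_grad_graph x : enorm (grad u x) = slope G (enorm x).
Proof.
rewrite -(slope_ratio_slope G_fix (enorm_ge0 x)).
apply/eqP; rewrite -(@eqrXn2 _ 2) ?enorm_ge0//; last first.
  by rewrite (slope_ratio_slope G_fix (enorm_ge0 x)) slope_ge0.
by rewrite (enorm_grad_radial (pderivE ^~ x)) exprMn enorm_sqr mulrC.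
Qed.

Lemma graph_spacelike x : enorm (grad u x) < 1.
Proof.
rewrite enorm_grad_graph -(@ltr_pXn2r _ 2) ?nnegrE ?slope_ge0// expr1n.
by rewrite -subr_gt0 (slope_sqr G_fix) invr_gt0 exprn_gt0// (lapse_gt0 G_fix).
Qed.

Let wE x : 1 - M (sqnorm x) ^+ 2 * sqnorm x = (lapse G (enorm x) ^+ 2)^-1.
Proof.
rewrite -(slope_sqr G_fix) -(slope_ratio_slope G_fix (enorm_ge0 x)).
by rewrite exprMn enorm_sqr mulrC.
Qed.

Let sqrt_wE x : Num.sqrt (1 - M (sqnorm x) ^+ 2 * sqnorm x) =
  (lapse G (enorm x))^-1.
Proof.
by rewrite wE -exprVn sqrtr_sqr ger0_norm// invr_ge0 ltW// (lapse_gt0 G_fix).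
Qed.

Lemma graph_curvatures x : 0 < mean_curvature 1 u x /\
  mean_curvature 2 u x = (h (enorm x) - lapse G (enorm x)) ^+ 2.
Proof.
have l0 := lapse_gt0 G_fix (enorm x).
have w0 : 0 < 1 - M (sqnorm x) ^+ 2 * sqnorm x.
  by rewrite wE invr_gt0 exprn_gt0.
have [-> ->] := mean_curvatures_radial m_gt0 w0 (pderivE ^~ x)
  (fun j k => pderiv2E j k x).
rewrite sqrt_wE wE.
have n0 : 0 < n%:R :> R by rewrite ltr0n.
have [->|x0] := eqVneq x 0.
  have e0 : enorm (0 : 'rV[R]_n) = 0 by rewrite /enorm -/(sqnorm 0) sqnorm0 sqrtr0.
  rewrite sqnorm0 e0 (lapse_at0 G_fix) mul0r addr0.
  have -> : M 0 = h 0 - 1 by rewrite /slope_ratio ltxx.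
  have h0 : 0 < h 0 - 1 by rewrite subr_gt0.
  split; last by rewrite -[n]add2n natrD; field; rewrite -natrD pnatr_eq0.
  by rewrite expr1n !invr1 !mulr1 divr1 divr_gt0// ltr_wpDl// mulr_ge0// ltW.
have r0 : 0 < enorm x by rewrite sqrtr_gt0 sqnorm_gt0.
have G0 : 0 < G (enorm x) := G_gt0 h_gt1 G_fix r0.
have dG0 := dG_gt0 m_gt0 h_cont h_gt1 h_mono G_fix r0.
move: (enorm x) r0 G0 dG0 l0 (enorm_sqr x) => r r0 G0 dG0 l0 rE.
have q0 : 0 < Num.sqrt (G r) by rewrite sqrtr_gt0.
rewrite -rE.
have lt_E : M (r ^+ 2) / (lapse G r)^-1 = Num.sqrt (G r) / r.
  by rewrite slope_ratioE// /slope; field; rewrite !gt_eqF.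
have lr_E : (M (r ^+ 2) + r ^+ 2 * N (r ^+ 2)) /
    ((lapse G r ^+ 2)^-1 * (lapse G r)^-1) = dG m h G r / (2 * Num.sqrt (G r)).
  rewrite /dslope_ratio [r ^+ 2 * _]mulrC divfK ?expf_neq0 ?gt_eqF//.
  rewrite addrC subrK sqrtr_sqr gtr0_norm// /dslope; field.
  by rewrite !gt_eqF.
rewrite lt_E lr_E; split.
  apply: divr_gt0 => //; apply: addr_gt0; last by rewrite divr_gt0// mulr_gt0.
  by rewrite mulr_gt0 ?ltr0n// divr_gt0.
rewrite expr_div_n sqr_sqrtr ?(ltW G0)// /dG kappa_sqr.
by rewrite -[n]add2n natrD; field; rewrite !gt_eqF// -natrD pnatr_eq0.
Qed.

Lemma graph_admissible : admissible u.
Proof.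
split; first exact: graph_classC2.
move=> x; have [m1 m2] := graph_curvatures x; split=> //.
  exact: graph_spacelike.
rewrite m2 exprn_gt0// subr_gt0.
exact: (lapse_lt_h m_gt0 h_cont h_gt1 h_mono G_fix (enorm_ge0 x)).
Qed.

Lemma graph_solution : is_solution h u.
Proof.
move=> x; have [_ ->] := graph_curvatures x.
rewrite (enorm_grad_radial (pderivE ^~ x)) sqrt_wE invrK.
rewrite sqrtr_sqr ger0_norm// subr_ge0 ltW//.
exact: (lapse_lt_h m_gt0 h_cont h_gt1 h_mono G_fix (enorm_ge0 x)).
Qed.

Let f r := U (r ^+ 2).

Lemma is_derive_profile (r : R) : 0 <= r -> is_derive r 1 f (slope G r).
Proof.
move=> r0; have := @is_derive_compfun _ _ (fun r : R => r ^+ 2) _ _ _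
  (DU0 (sqr_ge0 r)) (is_derive_expfun 2 (is_derive_idfun r)).
move/is_derive_eq; apply; rewrite -(slope_ratio_slope G_fix r0) /= expr1.
by field.
Qed.

Lemma graph_profile x : u x = f (enorm x).
Proof. by rewrite /f enorm_sqr. Qed.

Lemma graph_strictly_convex : strictly_convex u.
Proof.
have -> : u = (fun x => f (enorm x)) by apply/funext => x; exact: graph_profile.
apply: (strictly_convex_radial is_derive_profile).
  exact: (slope_incr m_gt0 h_cont h_gt1 h_mono G_fix).
by rewrite /slope (G_at0 G_fix) sqrtr0 mul0r.
Qed.

Lemma graph_radial : radial u.
Proof. by move=> x y xy; rewrite !graph_profile xy. Qed.

End Graph.

(** * Radial solutions and their uniqueness *)

Section Rays.
Variables (R : realType) (m : nat).
Local Notation n := m.+2.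

Definition ray (r : R) : 'rV[R]_n := r *: delta_mx 0 ord0.

Lemma enorm_ray r : enorm (ray r) = `|r|.
Proof.
rewrite enormZ -[RHS]mulr1; congr (_ * _).
rewrite /enorm (bigD1 ord0)//= big1 ?addr0 ?mxE ?eqxx ?expr1n ?sqrtr1//.
by move=> i /negbTE i0; rewrite mxE i0 andbF expr0n.
Qed.

Lemma continuous_ray : continuous ray.
Proof. exact: scalel_continuous. Qed.

Lemma is_derive_ray (w : 'rV[R]_n -> R) (r d : R) :
  is_derive (ray r) (delta_mx 0 ord0) w d -> is_derive r 1 (fun s => w (ray s)) d.
Proof.
move=> /is_derive_line D.
have D0 : is_derive (r - r) 1 (fun t : R => w (t *: delta_mx 0 ord0 + ray r)) d.
  by rewrite subrr.
have := @is_derive_compfun _ _ (fun s : R => s - r) _ _ _ D0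
  (is_derive_subfun (is_derive_idfun r) (is_derive_cstfun r r 1)).
rewrite subr0 mulr1.
have -> // : (fun s : R => w ((s - r) *: delta_mx 0 ord0 + ray r)) =
  (fun s => w (ray s)).
by apply/funext => s; rewrite /ray -scalerDl subrK.
Qed.

End Rays.

Section RadialEquation.
Variables (R : realType) (m : nat) (h : R -> R) (u : 'rV[R]_m.+2 -> R).
Hypotheses (m_gt0 : (0 < m)%N) (u_rad : radial u) (u_adm : admissible u).
Hypothesis u_sol : is_solution h u.
Local Notation n := m.+2.

Implicit Types (r : R) (x : 'rV[R]_n).

Let f r := u (ray m r).
Let d1 r := pderiv ord0 u (ray m r).
Let d2 r := pderiv ord0 (pderiv ord0 u) (ray m r).
Let w r := 1 - d1 r ^+ 2.

Definition tilt r := d1 r / Num.sqrt (w r).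
Let dtilt r := d2 r / (w r * Num.sqrt (w r)).

Lemma radialE x : u x = f (enorm x).
Proof. by apply: u_rad; rewrite enorm_ray ger0_norm// enorm_ge0. Qed.

Lemma is_derive_radial_profile r : is_derive r 1 f (d1 r).
Proof.
apply: is_derive_ray; apply: DeriveDef => //.
by have [[_ /(_ ord0)[du _]] _] := u_adm.
Qed.

Let Dd1 r : is_derive r 1 d1 (d2 r).
Proof.
apply: is_derive_ray; apply: DeriveDef => //.
by have [[_ /(_ ord0)[_ [_ /(_ ord0)[du _]]]] _] := u_adm.
Qed.

Let d1_cont : continuous d1.
Proof. by move=> r; exact: is_derive_continuous (Dd1 r). Qed.

Let M s := d1 (Num.sqrt s) / Num.sqrt s.
Let N s := (d2 (Num.sqrt s) - M s) / s.
Let U s := f (Num.sqrt s).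

Let DU (s : R) : 0 < s -> is_derive s 1 U (M s / 2).
Proof.
move=> s0; have r0 : 0 < Num.sqrt s by rewrite sqrtr_gt0.
have := is_derive_compfun (is_derive_radial_profile _)
  (is_derive_sqrtfun (is_derive_idfun s) s0).
by move/is_derive_eq; apply; rewrite /M; field; rewrite gt_eqF.
Qed.

Let DM (s : R) : 0 < s -> is_derive s 1 M (N s / 2).
Proof. by move=> s0; apply: is_derive_ratio_sqrt. Qed.

Let uE : u = (fun x => U (sqnorm x)).
Proof. by apply/funext => x; rewrite radialE. Qed.

Let pderivE i x : x != 0 -> pderiv i u x = M (sqnorm x) * x 0 i.
Proof.
move=> x0; have x1 : 0 < sqnorm x by rewrite sqnorm_gt0.
by have [_ <-] := is_derive_radial i (DU x1); rewrite /pderiv uE.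
Qed.

Let pderiv2E i j x : x != 0 -> pderiv j (pderiv i u) x =
  M (sqnorm x) * (i == j)%:R + N (sqnorm x) * x 0 i * x 0 j.
Proof.
move=> x0; have x1 : 0 < sqnorm x by rewrite sqnorm_gt0.
have [_ <-] := is_derive_radial_field i j (DM x1).
apply: near_eq_derive.
have : \forall y \near x, 0 < sqnorm y.
  by apply: (cvgr_gt _ (@continuous_sqnorm R n x)).
by apply: filterS => y y0; apply: pderivE; rewrite -sqnorm_gt0.
Qed.

Let ray_neq0 r : 0 < r -> ray m r != 0.
Proof.
by move=> r0; rewrite -sqnorm_gt0 -enorm_sqr enorm_ray exprn_gt0// normr_gt0 gt_eqF.
Qed.

Let sqnorm_ray r : sqnorm (ray m r) = r ^+ 2.
Proof. by rewrite -enorm_sqr enorm_ray real_normK ?num_real. Qed.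

Let M_ray r : 0 < r -> M (r ^+ 2) = d1 r / r.
Proof. by move=> r0; rewrite /M sqrtr_sqr gtr0_norm. Qed.

Let grad_ray r : 0 < r -> enorm (grad u (ray m r)) ^+ 2 = d1 r ^+ 2.
Proof.
move=> r0.
have H i : pderiv i u (ray m r) = M (sqnorm (ray m r)) * ray m r 0 i.
  by apply: pderivE; exact: ray_neq0.
rewrite (enorm_grad_radial H) sqnorm_ray M_ray// expr_div_n divfK//.
by rewrite expf_neq0// gt_eqF.
Qed.

Let w_gt0 r : 0 < w r.
Proof.
have [_ /(_ (ray m r))[sp _ _]] := u_adm.
have : enorm (grad u (ray m r)) ^+ 2 < 1 by rewrite expr_lt1// enorm_ge0.
rewrite enorm_sqr subr_gt0; apply: le_lt_trans.
by have := sqr_coord_le (grad u (ray m r)) ord0; rewrite mxE.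
Qed.

Let curv_ray r : 0 < r ->
  mean_curvature 1 u (ray m r) = (m.+1%:R * (tilt r / r) + dtilt r) / n%:R /\
  mean_curvature 2 u (ray m r) =
    (m%:R * (tilt r / r) ^+ 2 + 2 * ((tilt r / r) * dtilt r)) / n%:R.
Proof.
move=> r0; have x0 := ray_neq0 r0.
have wE : 1 - M (sqnorm (ray m r)) ^+ 2 * sqnorm (ray m r) = w r.
  by rewrite sqnorm_ray M_ray// expr_div_n divfK// expf_neq0// gt_eqF.
have w1 : 0 < 1 - M (sqnorm (ray m r)) ^+ 2 * sqnorm (ray m r).
  by rewrite wE w_gt0.
have := mean_curvatures_radial m_gt0 w1 (fun i => pderivE i x0)
  (fun j k => pderiv2E j k x0).
rewrite wE sqnorm_ray /=.
have -> : M (r ^+ 2) / Num.sqrt (w r) = tilt r / r by rewrite M_ray// mulrAC.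
have -> // : (M (r ^+ 2) + r ^+ 2 * N (r ^+ 2)) / (w r * Num.sqrt (w r)) = dtilt r.
rewrite /N [r ^+ 2 * _]mulrC divfK ?expf_neq0 ?gt_eqF//.
by rewrite addrC subrK sqrtr_sqr gtr0_norm.
Qed.

Lemma tilt_lapse r : 0 < r -> Num.sqrt (1 + tilt r ^+ 2) = (Num.sqrt (w r))^-1.
Proof.
move=> r0; have w0 := w_gt0 r.
have -> : 1 + tilt r ^+ 2 = (w r)^-1.
  rewrite /tilt expr_div_n sqr_sqrtr ?(ltW w0)// /w; field.
  by rewrite gt_eqF.
by rewrite sqrtrV// ltW.
Qed.

Lemma is_derive_tilt r : 0 < r -> is_derive r 1 tilt (dtilt r).
Proof.
move=> r0; have w0 := w_gt0 r.
have s0 : 0 < Num.sqrt (w r) by rewrite sqrtr_gt0.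
have Dw := is_derive_subfun (is_derive_cstfun 1 r 1) (is_derive_expfun 2 (Dd1 r)).
have := is_derive_mulfun (Dd1 r)
  (is_derive_invfun (is_derive_sqrtfun Dw w0) (lt0r_neq0 s0)).
move/is_derive_eq; apply; rewrite -/(w r) /dtilt /= expr1 sub0r.
have -> : d2 r / (w r * Num.sqrt (w r)) =
    d2 r * (w r + d1 r ^+ 2) / Num.sqrt (w r) ^+ 3.
  have -> : w r + d1 r ^+ 2 = 1 by rewrite /w subrK.
  by rewrite mulr1 [_ ^+ 3]exprSr sqr_sqrtr// ltW.
rewrite -[X in X + d1 r ^+ 2](@sqr_sqrtr _ (w r)) ?(ltW w0)//.
by field; rewrite gt_eqF.
Qed.

(** Multiplied by [r ^+ m.+1] the second mean curvature is an exact derivative,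
    and the rest of the equation involves the tilt only through its square. *)
Lemma is_derive_weighted_tilt r : 0 < r ->
  is_derive r 1 (fun s : R => s ^+ m * tilt s ^+ 2)
    (n%:R * r ^+ m.+1 * (h r - Num.sqrt (1 + tilt r ^+ 2)) ^+ 2).
Proof.
move=> r0; have [_ c2] := curv_ray r0.
have [_ /(_ (ray m r))[_ _ c2_gt0]] := u_adm.
have := u_sol (ray m r); rewrite enorm_ray (gtr0_norm r0) (grad_ray r0).
rewrite -/(w r) -(tilt_lapse r0) => <-.
rewrite sqr_sqrtr ?(ltW c2_gt0)// c2.
have := is_derive_mulfun (is_derive_expfun m (is_derive_idfun r))
  (is_derive_expfun 2 (is_derive_tilt r0)).
move/is_derive_eq; apply.
have mE : r ^+ m = r ^+ m.-1 * r by rewrite -exprSr prednK.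
rewrite /= expr1 mulr1 [r ^+ m.+1]exprS mE -[n]add2n natrD; field.
by rewrite -natrD pnatr_eq0 (gt_eqF r0).
Qed.

Lemma tilt_root_curv_ge0 r : 0 < r -> 0 <= h r - Num.sqrt (1 + tilt r ^+ 2).
Proof.
move=> r0; have := u_sol (ray m r).
rewrite enorm_ray (gtr0_norm r0) (grad_ray r0) -/(w r) -(tilt_lapse r0) => <-.
exact: sqrtr_ge0.
Qed.

Lemma continuous_tilt r : {for r, continuous tilt}.
Proof.
have c1 : {for r, continuous (fun s => Num.sqrt (w s))}.
  apply: continuous_comp; last exact: sqrt_continuous.
  apply: cvgB; first exact: cvg_cst.
  apply: (@continuous_comp _ _ _ d1 (fun t => t ^+ 2)); first exact: d1_cont.
  exact: exprn_continuous.
apply: continuous_mulfun; first exact: d1_cont.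
apply: cvgV; last exact: c1.
by rewrite gt_eqF// sqrtr_gt0.
Qed.

(** The mean curvature is the divergence of the tilt, so its sign fixes that
    of the tilt. *)
Lemma tilt_gt0 r : 0 < r -> 0 < tilt r.
Proof.
move=> r0; rewrite -(pmulr_rgt0 _ (exprn_gt0 m.+1 r0)).
have -> : 0 = 0 ^+ m.+1 * tilt 0 by rewrite expr0n mul0r.
apply: (@lt_of_derive _ (fun s => s ^+ m.+1 * tilt s)
  (fun s => s ^+ m.+1 * dtilt s + tilt s * (m.+1%:R * s ^+ m * 1))) => //.
- apply: continuous_subspaceT => s.
  apply: (@continuous_mulfun _ _ (fun s : R => s ^+ m.+1)).
    exact: exprn_continuous.
  exact: continuous_tilt.
- move=> s /andP[s0 _]; apply: is_derive_mulfun; last exact: is_derive_tilt.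
  by have := is_derive_expfun m.+1 (is_derive_idfun s).
- move=> s /andP[s0 _].
  have [c1 _] := curv_ray s0; have [_ /(_ (ray m s))[_ + _]] := u_adm.
  rewrite c1 pmulr_lgt0 ?invr_gt0 ?ltr0n// => H.
  have -> : s ^+ m.+1 * dtilt s + tilt s * (m.+1%:R * s ^+ m * 1) =
      s ^+ m.+1 * (m.+1%:R * (tilt s / s) + dtilt s).
    by rewrite exprSr; field; rewrite gt_eqF.
  by rewrite mulr_gt0// exprn_gt0.
Qed.

Lemma is_derive_profile_tilt r : 0 < r ->
  is_derive r 1 f (tilt r / Num.sqrt (1 + tilt r ^+ 2)).
Proof.
move=> r0; apply: is_derive_eq (is_derive_radial_profile r) _.
by rewrite tilt_lapse// invrK /tilt divfK// gt_eqF// sqrtr_gt0 w_gt0.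
Qed.

End RadialEquation.

Section Uniqueness.
Variables (R : realType) (m : nat) (h : R -> R) (u v : 'rV[R]_m.+2 -> R).
Hypotheses (m_gt0 : (0 < m)%N).
Hypotheses (u_rad : radial u) (u_adm : admissible u) (u_sol : is_solution h u).
Hypotheses (v_rad : radial v) (v_adm : admissible v) (v_sol : is_solution h v).
Implicit Types r : R.

Let P (w : 'rV[R]_m.+2 -> R) r := r ^+ m * tilt w r ^+ 2.
Let Q (w : 'rV[R]_m.+2 -> R) r :=
  m.+2%:R * r ^+ m.+1 * (h r - Num.sqrt (1 + tilt w r ^+ 2)) ^+ 2.

(** The right-hand side of the radial equation is a decreasing function of the
    squared tilt, so the square of the difference of two solutions cannot
    grow. *)
Lemma tilt_unique r : 0 < r -> tilt u r = tilt v r.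
Proof.
move=> r0; pose D s := P u s - P v s.
have DD (s : R) : 0 < s -> is_derive s 1 D (Q u s - Q v s).
  move=> s0; apply: is_derive_subfun.
    exact: (is_derive_weighted_tilt m_gt0 u_rad u_adm u_sol s0).
  exact: (is_derive_weighted_tilt m_gt0 v_rad v_adm v_sol s0).
have cP w s : {for s, continuous (tilt w)} -> {for s, continuous (P w)}.
  move=> cw; apply: continuous_mulfun; first exact: exprn_continuous.
  apply: (@continuous_comp _ _ _ (tilt w) (fun t => t ^+ 2)); first exact: cw.
  exact: exprn_continuous.
have cD s : {for s, continuous D}.
  by apply: cvgB; apply: cP; exact: continuous_tilt.
have DQ (s : R) : 0 < s -> D s * (Q u s - Q v s) <= 0.
  move=> s0.
  have a0 := tilt_root_curv_ge0 u_rad u_adm u_sol s0.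
  have b0 := tilt_root_curv_ge0 v_rad v_adm v_sol s0.
  have -> : D s * (Q u s - Q v s) =
    s ^+ m * (m.+2%:R * s ^+ m.+1) * ((tilt u s ^+ 2 - tilt v s ^+ 2) *
    ((h s - Num.sqrt (1 + tilt u s ^+ 2)) ^+ 2 -
     (h s - Num.sqrt (1 + tilt v s ^+ 2)) ^+ 2)) by rewrite /D /P /Q; ring.
  have c0 : 0 < s ^+ m * (m.+2%:R * s ^+ m.+1).
    by rewrite !mulr_gt0 ?exprn_gt0.
  rewrite (pmulr_rle0 _ c0).
  have mono (x y : R) : x <= y -> 0 <= h s - Num.sqrt (1 + y) ->
    (h s - Num.sqrt (1 + y)) ^+ 2 <= (h s - Num.sqrt (1 + x)) ^+ 2.
    move=> xy y0; have : Num.sqrt (1 + x) <= Num.sqrt (1 + y).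
      by rewrite ler_wsqrtr// lerD2l.
    by move=> sxy; rewrite lerXn2r ?nnegrE//; lra.
  have [uv|/ltW vu] := leP (tilt u s ^+ 2) (tilt v s ^+ 2).
    by apply: mulr_le0_ge0; [rewrite subr_le0|rewrite subr_ge0; exact: mono].
  by apply: mulr_ge0_le0; [rewrite subr_ge0|rewrite subr_le0; exact: mono].
have P0 w : P w 0 = 0 by rewrite /P expr0n eqn0Ngt m_gt0 mul0r.
have : D r ^+ 2 <= 0.
  have -> : 0 = D 0 ^+ 2 by rewrite /D !P0 subrr expr0n.
  rewrite -lerN2.
  apply: (@le_of_derive _ (fun s => - D s ^+ 2)
    (fun s => - (2%:R * D s ^+ 1 * (Q u s - Q v s)))).
  - exact: ltW.
  - apply: within_continuous_for => s _; apply: cvgN.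
    apply: (@continuous_comp _ _ _ D (fun t => t ^+ 2)); first exact: cD.
    exact: exprn_continuous.
  - move=> s /andP[s0 _]; apply: is_derive_oppfun.
    exact: is_derive_expfun (DD s s0).
  - by move=> s /andP[s0 _]; have := DQ s s0; rewrite expr1; lra.
rewrite le_eqVlt ltNge sqr_ge0 orbF sqrf_eq0 subr_eq0 => /eqP.
rewrite /P => /(mulfI (expf_neq0 m (lt0r_neq0 r0))) /eqP.
rewrite eqrXn2 ?(ltW (tilt_gt0 _ _ _ _))// => /eqP//.
Qed.

Lemma radial_solution_unique : exists c : R, forall x, u x = v x + c.
Proof.
pose fu r := u (ray m r); pose fv r := v (ray m r).
exists (fu 0 - fv 0) => x.
rewrite (radialE u_rad) (radialE v_rad) -/(fu _) -/(fv _).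
move: (enorm_ge0 x); rewrite le_eqVlt => /orP[/eqP<-|r0].
  by rewrite addrC subrK.
move: (enorm x) r0 => r r0.
have Df (w : 'rV[R]_m.+2 -> R) s : admissible w ->
    {for s, continuous (fun r => w (ray m r))}.
  by move=> aw; exact: is_derive_continuous (is_derive_radial_profile aw s).
have Du := is_derive_profile_tilt u_adm.
have Dv := is_derive_profile_tilt v_adm.
suff : fu 0 - fv 0 = fu r - fv r by move=> ->; ring.
apply/le_anti/andP; split.
- apply: (@le_of_derive _ (fun s => fu s - fv s) (fun=> 0)) => //.
  + exact: ltW.
  + by apply: within_continuous_for => s _; apply: cvgB; exact: Df.
  + move=> s /andP[s0 _]; have := is_derive_subfun (Du s s0) (Dv s s0).
    by move/is_derive_eq; apply; rewrite tilt_unique// subrr.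
- rewrite -lerN2 !opprB.
  apply: (@le_of_derive _ (fun s => fv s - fu s) (fun=> 0)) => //.
  + exact: ltW.
  + by apply: within_continuous_for => s _; apply: cvgB; exact: Df.
  + move=> s /andP[s0 _]; have := is_derive_subfun (Dv s s0) (Du s s0).
    by move/is_derive_eq; apply; rewrite tilt_unique// subrr.
Qed.

End Uniqueness.

(** * Existence, asymptotics and uniqueness *)

Lemma cvg_enorm_oo (R : realType) n : enorm x @[x --> @enorm_oo R n] --> +oo.
Proof.
move=> A [M [_ MA]]; exists M => // x /= Mx; exact: MA.
Qed.

(* H : R -> R stands for a function on [0, +oo): only its values on
   nonnegative reals are used. *)
Theorem theorem1 (R : realType) (n : nat) (C : R) (H : R -> R)
    (n_gt2 : (2 < n)%N)
    (C_gt1 : 1 < C)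
    (H_nondecreasing : forall r s : R, 0 <= r -> r <= s -> H r <= H s)
    (H_smooth : smooth (fun x : 'rV[R]_n => H (enorm x)))
    (H_inf : 1 < inf [set H r | r in [set r : R | 0 <= r]])
    (H_lim : H r @[r --> +oo] --> C) :
  let H_decay :=
    exists2 K : R, 0 < K &
      \forall r \near +oo, `|1 - H r / C| <= K * `|(r ^+ 2)^-1| in
  (exists u : 'rV[R]_n -> R,
    [/\ radial u, admissible u, is_solution H u, strictly_convex u &
        enorm (grad u x) @[x --> @enorm_oo R n] --> Num.sqrt (1 - (C ^+ 2)^-1)]
    /\
    (H_decay ->
     exists c0 : R,
       u x - (Num.sqrt (1 - (C ^+ 2)^-1) * enorm x
              - (C ^+ 2)^-1 * Num.sqrt ((n%:R - 2) / n%:R) * ln (enorm x)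
              + c0)
         @[x --> @enorm_oo R n] --> 0)) /\
  (H_decay ->
   forall u v : 'rV[R]_n -> R,
     radial u -> admissible u -> is_solution H u ->
     radial v -> admissible v -> is_solution H v ->
     exists c : R, forall x, u x = v x + c).
Proof.
case: n n_gt2 H_smooth => [|[|[|m]]]// _ H_smooth H_decay.
split; last first.
  move=> _ u v u_rad u_adm u_sol v_rad v_adm v_sol.
  exact: (@radial_solution_unique _ m.+1 H).
pose h (r : R) : R := H `|r|.
have h_cont : continuous h.
  have [cH _] := H_smooth 0%N.
  have -> : h = (fun x : 'rV[R]_m.+3 => H (enorm x)) \o ray m.+1.
    by apply/funext => r; rewrite /= enorm_ray.
  by move=> r; apply: continuous_comp; [exact: continuous_ray|exact: cH].
have h_mono r s : 0 <= r -> r <= s -> h r <= h s.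
  move=> r0 rs; rewrite /h !ger0_norm ?(le_trans r0)//; exact: H_nondecreasing.
have h_gt1 r : 1 < h r.
  apply: lt_le_trans H_inf _; apply: ge_inf; last by exists `|r| => /=.
  by exists (H 0) => _ [s /= s0 <-]; exact: H_nondecreasing.
have hH : \forall r \near +oo, h r = H r.
  near=> r; have r0 : 0 <= r by near: r; apply: nbhs_pinfty_ge; exact: num_real.
  by rewrite /h ger0_norm.
have h_lim : h r @[r --> +oo] --> C.
  apply: cvg_trans H_lim; apply: near_eq_cvg.
  by apply: filterS hH => r ->.
have h_le r : h r <= C.
  rewrite /h; rewrite -(cvg_lim _ H_lim)//; apply: limr_ge.
    by apply/cvg_ex; exists C.
  near=> s; have rs : `|r| <= s.
    by near: s; apply: nbhs_pinfty_ge; exact: num_real.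
  exact: H_nondecreasing.
have h_ge0 r : 0 <= h r by apply: ltW; apply: lt_trans (h_gt1 r).
have m0 : (0 < m.+1)%N by [].
have [G G_fix] := exists_squared_tilt m0 h_cont h_ge0 h_le.
have M_cont := continuous_slope_ratio m0 h_cont h_gt1 h_mono G_fix.
have [U [_ DU]] : exists U : R -> R, U 0 = 0 /\
    forall s : R, -1 < s -> is_derive s 1 U (slope_ratio h G s / 2).
  apply: exists_primitive => s; apply: cvgM; [exact: M_cont|exact: cvg_cst].
exists (fun x => U (sqnorm x)); split.
  split.
  - exact: graph_radial.
  - exact: (graph_admissible m0 h_cont h_gt1 h_mono G_fix DU).
  - move=> x; have := graph_solution m0 h_cont h_gt1 h_mono G_fix DU x.
    by rewrite /h ger0_norm ?enorm_ge0.
  - exact: (graph_strictly_convex m0 h_cont h_gt1 h_mono G_fix DU).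
  - under eq_fun do rewrite (enorm_grad_graph G_fix DU).
    apply: cvg_comp (cvg_enorm_oo _) _.
    exact: (slope_lim m0 h_cont h_gt1 h_le h_mono G_fix h_lim).
move=> [K K0 decay].
have h_decay : exists2 K : R, 0 < K &
    \forall r \near +oo, `|1 - h r / C| <= K * `|(r ^+ 2)^-1|.
  by exists K => //; apply: filterS2 hH decay => r ->.
have Df (r : R) : 0 < r -> is_derive r 1 (fun r => U (r ^+ 2)) (slope G r).
  by move=> r0; apply: (is_derive_profile G_fix DU); exact: ltW.
have [c0 lim] := profile_asymptotics m0 h_cont h_gt1 h_le h_mono G_fix Df h_decay.
exists c0.
have -> : Num.sqrt ((m.+3%:R - 2) / m.+3%:R) = tilt_ratio R m.+1.
  by rewrite /tilt_ratio -[in X in X - _]addn2 natrD addrK.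
under eq_fun do rewrite graph_profile.
exact: cvg_comp (cvg_enorm_oo _) lim.
Unshelve. all: by end_near. Qed.
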